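(* $|F(n,4,9)|=2^{\gamma n^2+o(n^2)}$, where $\beta=\frac{\log 3}{2\log 3-\log 2}$ and $\gamma=\beta^2/2+\beta(1-\beta)\log_2 3$.
   Context: A multigraph is a pair $(V,w)$ with $w:\binom{V}{2}\to\mathbb{N}=\{0,1,2,\dots\}$. $F(n,4,9)$ is the set of multigraphs on vertex set $[n]=\{1,\dots,n\}$ such that every 4 vertices span total multiplicity at most 9, i.e. $\sum_{xy\in\binom{X}{2}}w(xy)\le 9$ for all $X\in\binom{[n]}{4}$. Logarithms are natural. *)

(* Defs.v *)
From HB Require Import structures.
From mathcomp Require Import all_boot all_order all_algebra finmap.
From mathcomp Require Import all_classical all_reals all_analysis.
Set Implicit Arguments.
Unset Strict Implicit.
Unset Printing Implicit Defensive.
Import Order.TTheory GRing.Theory Num.Theory.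

Local Open Scope ring_scope.

Notation pair2 V := {e : {set V} | #|e| == 2%N}.

Notation multigraph V := {ffun pair2 V -> nat}.

Definition span_mult (V : finType) (w : multigraph V) (X : {set V}) : nat :=
  (\sum_(e : pair2 V | val e \subset X) w e)%N.

(* F(n, s, q): the vertex set [n] is represented by 'I_n = {0, ..., n-1}. *)
Definition F (n s q : nat) : set (multigraph 'I_n) :=
  [set w : multigraph 'I_n |
    forall X : {set 'I_n}, #|X| = s -> (span_mult w X <= q)%N]%classic.
Arguments F n s q : clear implicits.

(* fset_set A is empty when A is infinite, so the cardinal is the intended one
   only when F n s q is finite; for s = 4 this means n >= 4 (or n <= 1). *)
Definition card_F (n s q : nat) : nat := #|` fset_set (F n s q)|%fset.

Definition beta (R : realType) : R := ln 3 / (2 * ln 3 - ln 2).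

Definition gamma (R : realType) : R :=
  beta R ^+ 2 / 2 + beta R * (1 - beta R) * (ln 3 / ln 2).

(* Main.v *)
(* Upper bound. Let w be uniform on F(n,4,9).  By symmetry, the conditional
   entropy h_k of w(uv) given all edges between a k-set S, u and v (and inside S)
   depends only on k, and it decreases with k, so some k = O(1) has h_k - h_(k+m)
   tiny.  The edges inside an m-set Y disjoint from S are then almost independent
   given the edges meeting S: the relative entropy of their joint law with respect
   to the product of the marginals is at most C(m,2) (h_k - h_(k+m)).  Since the
   joint law never violates the local condition, the graph c of the largest values
   of non-negligible marginal probability satisfies it with high probability, and
   h_k is at most the average of ln(c + 1) over the pairs of Y, up to o(1).  As
   revealing S costs O(n), this bounds ln |F(n,4,9)| by n^2/2 times the maximal
   average of ln(c + 1), c being a locally sparse multigraph on m vertices.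

   Extremal problem. Pairs with c >= 3 form a K_{2,2}-free graph, hence are
   negligible.  If c <= 2 then some vertex has ln(c + 1)-degree at most
   beta ln 3 m + O(1), and one removes it and inducts.  Indeed this holds on average
   over (i) a triangle of 2's; (ii) a vertex x with three neighbours at multiplicity
   2 which are pairwise joined by 1's, with weights 1 - beta on x and beta/3 on the
   others.  If neither configuration exists, let b maximise the number of its
   2-neighbours: on these, the pairs of multiplicity 1 form a triangle-free graph,
   so some 2-neighbour of b has multiplicity 0 to half of them.

   Lower bound. Fix a set P of beta n vertices and allow multiplicities up to 1
   inside P, 2 between P and its complement, and 0 elsewhere. *)
Require Import Defs.
From HB Require Import structures.
From mathcomp Require Import all_boot all_order all_algebra finmap.
From mathcomp Require Import all_classical all_reals all_analysis.
From mathcomp Require Import ring lra zify.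
(* Required again so that their names take precedence over the homonyms of
   classical_sets. *)
From mathcomp Require Import fintype finset.
Set Implicit Arguments.
Unset Strict Implicit.
Unset Printing Implicit Defensive.
Import Order.TTheory GRing.Theory Num.Theory.
Local Open Scope ring_scope.

(** * Entropy of uniformly distributed words *)

Section Entropy.
Variables (R : realType) (E : finType) (q : nat).
Local Notation word := {ffun E -> 'I_q.+1}.
Variable A : {set word}.
Hypothesis A_gt0 : (0 < #|A|)%N.

Definition agree (P : {set E}) (w v : word) := [forall e in P, w e == v e].

Definition cls (P : {set E}) (w : word) := [set v in A | agree P w v].

Definition mean (f : word -> R) : R := (\sum_(w in A) f w) / #|A|%:R.

Definition entropy (P : {set E}) : R :=
  ln #|A|%:R - mean (fun w => ln #|cls P w|%:R).

Definition restr (T : {set E}) (w : word) : word :=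
  [ffun e => if e \in T then w e else ord0].

Definition cprob (Z : {set E}) (e : E) (w : word) (a : 'I_q.+1) : R :=
  #|[set v in cls Z w | v e == a]|%:R / #|cls Z w|%:R.

Lemma agreeP (P : {set E}) (w v : word) :
  reflect {in P, forall e, w e = v e} (agree P w v).
Proof. exact: eqfun_inP. Qed.

Lemma agreexx P w : agree P w w.
Proof. exact/agreeP. Qed.

Lemma agree_sym P w v : agree P w v = agree P v w.
Proof. by apply: eq_forallb => e; rewrite eq_sym. Qed.

Lemma agreeS (P Q : {set E}) w v : P \subset Q -> agree Q w v -> agree P w v.
Proof. by move=> /subsetP PQ /agreeP wv; apply/agreeP => e /PQ /wv. Qed.

Lemma agreeU P Q w v : agree (P :|: Q) w v = agree P w v && agree Q w v.
Proof.
apply/idP/andP => [wv|[/agreeP wvP /agreeP wvQ]].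
  by split; apply: agreeS wv; rewrite (subsetUl, subsetUr).
by apply/agreeP => e; rewrite inE => /orP[/wvP|/wvQ].
Qed.

Lemma agree_cls P w v : agree P w v -> cls P w = cls P v.
Proof.
move=> /agreeP wv; apply/setP => u; rewrite !inE; congr (_ && _).
by apply/agreeP/agreeP => uv e eP; rewrite -uv// wv.
Qed.

Lemma cls_gt0 P w : w \in A -> (0 < #|cls P w|)%N.
Proof. by move=> wA; apply/card_gt0P; exists w; rewrite inE wA agreexx. Qed.

Lemma clsR_gt0 P w : w \in A -> 0 < #|cls P w|%:R :> R.
Proof. by move=> wA; rewrite ltr0n cls_gt0. Qed.

Lemma restr_eq T w v : (restr T w == restr T v) = agree T w v.
Proof.
apply/eqP/agreeP => [/ffunP wv e eT|wv].
  by have := wv e; rewrite !ffunE eT.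
by apply/ffunP => e; rewrite !ffunE; case: ifP => // /wv.
Qed.

Let cA : R := #|A|%:R.
Let cA_gt0 : 0 < cA. Proof. by rewrite ltr0n. Qed.
Let cA_neq0 : cA != 0. Proof. by rewrite gt_eqF. Qed.

Lemma meanD f g : mean (fun w => f w + g w) = mean f + mean g.
Proof. by rewrite /mean big_split mulrDl. Qed.

Lemma meanN f : mean (fun w => - f w) = - mean f.
Proof. by rewrite /mean sumrN mulNr. Qed.

Lemma meanB f g : mean (fun w => f w - g w) = mean f - mean g.
Proof. by rewrite meanD meanN. Qed.

Lemma meanZ k f : mean (fun w => k * f w) = k * mean f.
Proof. by rewrite /mean -mulr_sumr mulrA. Qed.

Lemma mean_cst k : mean (fun=> k) = k.
Proof. by rewrite /mean sumr_const -(mulr_natr k) mulfK. Qed.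

Lemma ler_mean f g : (forall w, w \in A -> f w <= g w) -> mean f <= mean g.
Proof.
by move=> fg; rewrite ler_pM2r ?invr_gt0//; apply: ler_sum => w; apply: fg.
Qed.

Lemma eq_mean f g : (forall w, w \in A -> f w = g w) -> mean f = mean g.
Proof. by move=> fg; rewrite /mean; congr (_ / _); apply: eq_bigr. Qed.

Lemma mean_sum (I : finType) (P : pred I) (f : I -> word -> R) :
  mean (fun w => \sum_(i | P i) f i w) = \sum_(i | P i) mean (f i).
Proof. by rewrite /mean exchange_big mulr_suml. Qed.

Lemma mean_swap (Z T : {set E}) (g : word -> word -> R) :
    (forall w v y, agree Z w v -> g w y = g v y) ->
    (forall w y, g w (restr T y) = g w y) ->
  mean (fun w => g w w * (#|cls Z w|%:R / #|cls (Z :|: T) w|%:R)) =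
  mean (fun w => \sum_(y in restr T @: cls Z w) g w y).
Proof.
move=> gZ gT; rewrite /mean; congr (_ / _).
transitivity (\sum_(w in A) \sum_(v in A | agree Z w v)
    g w w / #|cls (Z :|: T) w|%:R).
  apply: eq_bigr => w wA; rewrite (eq_bigl (mem (cls Z w))); last first.
    by move=> v; rewrite !inE.
  by rewrite sumr_const -(mulr_natr (_ / _)) mulrAC -mulrA.
rewrite (exchange_big_dep (mem A))//=; last by move=> w v _ /andP[].
apply: eq_bigr => v vA.
transitivity (\sum_(w in cls Z v) g v w / #|cls (Z :|: T) w|%:R).
  apply: eq_big => [w|w /and3P[wA _ wv]]; last by rewrite (gZ _ _ _ wv).
  by rewrite !inE vA /= agree_sym.
rewrite (partition_big_imset (restr T))/=; apply: eq_bigr => _ /imsetP[u uv ->].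
have uA : u \in A by move: uv; rewrite inE => /andP[].
have vu : agree Z v u by move: uv; rewrite inE => /andP[].
rewrite (eq_bigl (mem (cls (Z :|: T) u))); last first.
  move=> w; rewrite !inE restr_eq agreeU -(agree_sym T u) andbA.
  congr (_ && _); rewrite -[LHS]andbT -[RHS]andbT; congr andb.
  have := agree_cls vu; move=> /setP/(_ w); rewrite !inE => ->//.
rewrite (eq_bigr (fun=> g v u / #|cls (Z :|: T) u|%:R)); last first.
  move=> w; rewrite !inE => /andP[wA uw]; rewrite (agree_cls uw); congr (_ / _).
  move: uw; rewrite agreeU -(restr_eq T) => /andP[_ /eqP uw].
  by rewrite -gT -uw gT.
by rewrite sumr_const -(mulr_natr (_ / _)) mulfVK ?gT// gt_eqF// clsR_gt0.
Qed.

Lemma ln_le_subr1 (x : R) : 0 < x -> ln x <= x - 1.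
Proof.
by move=> x0; have := @le_ln1Dx R (x - 1); rewrite (addrC 1) subrK; apply; lra.
Qed.

Lemma gibbs (Z T : {set E}) (g : word -> word -> R) :
    (forall w v y, agree Z w v -> g w y = g v y) ->
    (forall w y, g w (restr T y) = g w y) ->
    (forall w, w \in A -> 0 < g w w) ->
  entropy (Z :|: T) - entropy Z + 1 <=
  mean (fun w => - ln (g w w)) +
  mean (fun w => \sum_(y in restr T @: cls Z w) g w y).
Proof.
move=> gZ gT g0; rewrite -mean_swap// -[X in _ + X <= _]mean_cst /entropy.
rewrite (_ : _ - _ - _ = mean (fun w => ln #|cls Z w|%:R) -
   mean (fun w => ln #|cls (Z :|: T) w|%:R)); last by lra.
rewrite -meanB -!meanD; apply: ler_mean => w wA.
have cZ := clsR_gt0 Z wA; have cT := clsR_gt0 (Z :|: T) wA; have gw := g0 _ wA.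
rewrite /=; set x := (X in _ <= _ + X).
have x0 : 0 < x by rewrite mulr_gt0// divr_gt0.
have xE : ln x = ln (g w w) + (ln #|cls Z w|%:R - ln #|cls (Z :|: T) w|%:R).
  by rewrite lnM ?posrE ?divr_gt0// ln_div ?posrE.
by have := ln_le_subr1 x0; rewrite xE; lra.
Qed.

Lemma sum_restr_le (T : {set E}) (C : {set word}) (F : E -> 'I_q.+1 -> R) :
    (forall e a, 0 <= F e a) ->
  \sum_(y in restr T @: C) \prod_(e in T) F e (y e) <=
  \prod_(e in T) \sum_a F e a.
Proof.
move=> F0; rewrite (big_distr_big_dep (ord0 : 'I_q.+1))/=.
rewrite (big_mkcond (mem (pfamily _ _ _)))/= big_mkcond/=.
apply: ler_sum => y _; case: ifP => [/imsetP[w wC ->]|_]; last first.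
  by case: ifP => // _; apply: prodr_ge0.
rewrite ifT//; apply/pfamilyP; split=> //.
by apply/subsetP => e; rewrite inE ffunE; case: ifP => //; rewrite eqxx.
Qed.

Lemma cprob_ge0 Z e w a : 0 <= cprob Z e w a.
Proof. by rewrite divr_ge0. Qed.

Lemma cprob_self Z e w : cprob Z e w (w e) = #|cls (e |: Z) w|%:R / #|cls Z w|%:R.
Proof.
congr (_%:R / _); apply: eq_card => v; rewrite !inE agreeU -andbA; congr andb.
rewrite andbC; congr andb.
by apply/eqP/agreeP => [we f /set1P->//|->//]; rewrite set11.
Qed.

Lemma cprob_agree Z e w v a : agree Z w v -> cprob Z e w a = cprob Z e v a.
Proof. by rewrite /cprob => /agree_cls ->. Qed.

Lemma sum_cprob Z e w : w \in A -> \sum_a cprob Z e w a = 1.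
Proof.
move=> wA; rewrite -mulr_suml -natr_sum.
rewrite (_ : (\sum_a _)%N = #|cls Z w|) ?divff ?gt_eqF ?clsR_gt0//.
rewrite -sum1_card (partition_big (fun v : word => v e) predT)//=.
by apply: eq_bigr => a _; rewrite -sum1_card; apply: eq_bigl => v; rewrite !inE.
Qed.

Lemma entropy_step Z e :
  entropy (e |: Z) - entropy Z = mean (fun w => - ln (cprob Z e w (w e))).
Proof.
rewrite /entropy meanN.
rewrite [in RHS](eq_mean (g := fun w => ln #|cls (e |: Z) w|%:R - ln #|cls Z w|%:R)).
  by rewrite meanB; lra.
by move=> w wA; rewrite cprob_self ln_div ?posrE ?clsR_gt0.
Qed.

Lemma ln_prod (I : finType) (P : pred I) (F : I -> R) :
  (forall i, P i -> 0 < F i) ->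
  ln (\prod_(i | P i) F i) = \sum_(i | P i) ln (F i).
Proof.
move=> F0.
suff [] : 0 < \prod_(i | P i) F i /\
   ln (\prod_(i | P i) F i) = \sum_(i | P i) ln (F i) by [].
apply: (big_rec2 (fun x y => 0 < x /\ ln x = y)); first by rewrite ln1.
by move=> i x y Pi [x0 <-]; rewrite mulr_gt0 ?lnM ?posrE ?F0.
Qed.

(* The mean is the probability that resampling the letters of T independently,
   each given its Ze, produces a word incompatible with A given Z. *)
Lemma entropy_gap (Z T : {set E}) (Ze : E -> {set E}) :
    (forall e, e \in T -> Ze e \subset Z) ->
  entropy (Z :|: T) - entropy Z +
    mean (fun w => 1 - \sum_(y in restr T @: cls Z w)
                         \prod_(e in T) cprob (Ze e) e w (y e)) <=
  \sum_(e in T) (entropy (e |: Ze e) - entropy (Ze e)).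
Proof.
move=> ZeZ; pose g w (y : word) := \prod_(e in T) cprob (Ze e) e w (y e).
have p0 w e : w \in A -> 0 < cprob (Ze e) e w (w e).
  by move=> wA; rewrite cprob_self divr_gt0 ?clsR_gt0.
have := @gibbs Z T g.
rewrite meanB mean_cst (eq_bigr _ (fun e _ => entropy_step (Ze e) e)).
rewrite -mean_sum (eq_mean (f := fun w => - ln (g w w))
  (g := fun w => \sum_(e in T) - ln (cprob (Ze e) e w (w e)))); last first.
  by move=> w wA; rewrite ln_prod ?sumrN// => e _; apply: p0.
set h := mean _ => H; have {H} : entropy (Z :|: T) - entropy Z + 1 <=
  h + mean (fun w => \sum_(y in restr T @: cls Z w) g w y).
  apply: H => [w v y wv|w y|w wA].
  - by apply: eq_bigr => e eT; apply/cprob_agree/(agreeS (ZeZ _ eT)).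
  - by apply: eq_bigr => e eT; rewrite ffunE eT.
  - by apply: prodr_gt0 => e _; apply: p0.
by rewrite /g; lra.
Qed.

Lemma sum_prod_cprob_le1 (Z T : {set E}) (Ze : E -> {set E}) w : w \in A ->
  \sum_(y in restr T @: cls Z w) \prod_(e in T) cprob (Ze e) e w (y e) <= 1.
Proof.
move=> wA.
apply: le_trans (sum_restr_le T _ (fun e a => cprob_ge0 (Ze e) e w a)) _.
by rewrite big1// => e _; rewrite sum_cprob.
Qed.

Lemma entropy_subadditive (Z T : {set E}) (Ze : E -> {set E}) :
    (forall e, e \in T -> Ze e \subset Z) ->
  entropy (Z :|: T) - entropy Z <=
  \sum_(e in T) (entropy (e |: Ze e) - entropy (Ze e)).
Proof.
move=> /entropy_gap; apply: le_trans; rewrite lerDl -[leLHS]mean_cst.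
by apply: ler_mean => w wA; rewrite /= subr_ge0 sum_prod_cprob_le1.
Qed.

Lemma entropy_submodular (P Q : {set E}) e : P \subset Q ->
  entropy (e |: Q) - entropy Q <= entropy (e |: P) - entropy P.
Proof.
move=> PQ; have := @entropy_subadditive Q [set e] (fun=> P).
by rewrite big_set1 setUC; apply.
Qed.

Lemma entropy_gap_exceptional (Z T : {set E}) (Ze : E -> {set E}) (B : {set word})
    (c : word -> E -> 'I_q.+1) (d : R) :
    (forall e, e \in T -> Ze e \subset Z) -> B \subset A -> 0 <= d ->
    (forall w e, w \in B -> e \in T -> d <= cprob (Ze e) e w (c w e)) ->
    (forall w v, w \in B -> v \in A -> ~ {in T, forall e, v e = c w e}) ->
  entropy (Z :|: T) - entropy Z + d ^+ #|T| * (#|B|%:R / #|A|%:R) <=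
  \sum_(e in T) (entropy (e |: Ze e) - entropy (Ze e)).
Proof.
move=> ZeZ BA d0 dB Bc; apply: le_trans (entropy_gap ZeZ); rewrite lerD2l.
rewrite (_ : #|B|%:R / _ = mean (fun w => (w \in B)%:R)); last first.
  congr (_ / _); rewrite -sum1_card natr_sum big_mkcond [RHS]big_mkcond.
  by apply: eq_bigr => w _; case: ifP => [/(subsetP BA) ->|_]//; case: ifP.
rewrite -meanZ; apply: ler_mean => w wA /=.
case wB: (w \in B); last by rewrite mulr0 subr_ge0 sum_prod_cprob_le1.
rewrite mulr1 lerBrDr.
pose y0 := restr T [ffun e => c w e].
have y0N : y0 \notin restr T @: cls Z w.
  apply/negP => /imsetP[v]; rewrite inE => /andP[vA _] /ffunP y0v.
  apply: (Bc w v wB vA) => e eT.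
  by have := y0v e; rewrite !ffunE eT => ->.
have := @sum_restr_le T ([set [ffun e => c w e]] :|: cls Z w) _
   (fun e a => cprob_ge0 (Ze e) e w a).
rewrite imsetU imset_set1 big_setU1//= [leRHS]big1; last first.
  by move=> e _; rewrite sum_cprob.
apply: le_trans; rewrite lerD2r -prodr_const; apply: ler_prod => e eT.
by rewrite d0 !ffunE eT dB.
Qed.

Lemma entropy_step_le (Z : {set E}) (e : E) (c : word -> 'I_q.+1) (t : R) :
    0 < t <= 1 -> (forall w v, agree Z w v -> c w = c v) ->
    (forall w (a : 'I_q.+1), w \in A -> (c w < a)%N -> cprob Z e w a < t ^+ 2) ->
  entropy (e |: Z) - entropy Z <=
  mean (fun w => ln (c w).+1%:R) + q.+1%:R * t *+ 2.
Proof.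
move=> /andP[t0 t1] cZ ct; pose h (w : word) (a : 'I_q.+1) : R :=
  if (a <= c w)%N then (c w).+1%:R^-1 else t.
have h0 w a : 0 < h w a by rewrite /h; case: ifP => // _; rewrite invr_gt0.
pose g w (y : word) := h w (y e).
have sumh w : \sum_a h w a <= 1 + q.+1%:R * t.
  rewrite (bigID (fun a : 'I_q.+1 => (a <= c w)%N))/= lerD//.
    rewrite (eq_bigr (fun=> (c w).+1%:R^-1)) => [|a ac]; last by rewrite /h ac.
    rewrite -(big_ord_widen _ (fun=> (c w).+1%:R^-1) (ltn_ord (c w))).
    by rewrite sumr_const card_ord -(mulr_natr _^-1) mulVf// pnatr_eq0.
  rewrite (eq_bigr (fun=> t)) => [|a]; last by rewrite /h => /negbTE ->.
  rewrite sumr_const -(mulr_natl t) ler_wpM2r ?(ltW t0)// ler_nat.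
  by rewrite (leq_trans (max_card _)) ?card_ord.
have := @gibbs Z [set e] g; rewrite setUC => H.
have {H} : entropy (e |: Z) - entropy Z + 1 <= mean (fun w => - ln (h w (w e))) +
    mean (fun w => \sum_(y in restr [set e] @: cls Z w) h w (y e)).
  apply: H => [w v y wv|w y|w wA]; rewrite /g ?h0//.
    by rewrite /h (cZ _ _ wv).
  by rewrite /restr ffunE set11.
pose u (w : word) : R := (c w < w e)%N%:R.
have uE w : - ln (h w (w e)) <= ln (c w).+1%:R + t^-1 * u w.
  rewrite /h /u ltnNge; case: leqP => _ /=.
    by rewrite mulr0 addr0 lnV ?posrE ?opprK.
  rewrite mulr1 -lnV ?posrE//; have := @ln_le_subr1 t^-1.
  rewrite invr_gt0 t0 => /(_ isT); have : 0 <= ln (c w).+1%:R :> R.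
    by rewrite ln_ge0// ler1n.
  lra.
have mu : mean u <= q.+1%:R * t ^+ 2.
  pose g1 (w y : word) : R := 1.
  have := @mean_swap Z [set e] g1; move=> /(_ (fun _ _ _ _ => erefl) (fun _ _ => erefl)).
  rewrite setUC => S.
  have : mean (fun w => \sum_(y in restr [set e] @: cls Z w) g1 w y) <= q.+1%:R.
    rewrite -(mean_cst q.+1%:R); apply: ler_mean => w wA.
    have := @sum_restr_le [set e] (cls Z w) (fun _ _ => 1) (fun _ _ => ler01).
    rewrite [leRHS]big_set1 [leRHS]sumr_const card_ord; apply: le_trans.
    by apply: ler_sum => y _; rewrite big_set1.
  rewrite -{}S -(ler_pM2r (exprn_gt0 2 t0)); apply: le_trans.
  rewrite mulrC -meanZ; apply: ler_mean => w wA; rewrite /u /g1 mul1r.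
  case: ltnP => cw.
    have := ct w (w e) wA cw; rewrite cprob_self => /ltW.
    rewrite ler_pdivrMr ?clsR_gt0// => le1.
    by rewrite mulrA ler_pdivlMr ?clsR_gt0// mul1r.
  by rewrite mulr_ge0 ?exprn_ge0 ?(ltW t0)// divr_ge0.
have m1 : mean (fun w => - ln (h w (w e))) <=
    mean (fun w => ln (c w).+1%:R) + q.+1%:R * t.
  apply: (@le_trans _ _ (mean (fun w => ln (c w).+1%:R + t^-1 * u w))).
    by apply: ler_mean => w _; apply: uE.
  rewrite meanD meanZ lerD2l ler_pdivrMl//; apply: (le_trans mu).
  by rewrite expr2 mulrCA.
have m2 : mean (fun w => \sum_(y in restr [set e] @: cls Z w) h w (y e)) <=
    1 + q.+1%:R * t.
  rewrite -(mean_cst (1 + _)); apply: ler_mean => w wA.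
  apply: le_trans (sumh w).
  have := @sum_restr_le [set e] (cls Z w) (fun=> h w) (fun _ a => ltW (h0 w a)).
  rewrite big_set1; apply: le_trans.
  by apply: ler_sum => y _; rewrite big_set1.
by move=> H; rewrite mulr2n; lra.
Qed.

Lemma entropy_step_ge0 Z e : 0 <= entropy (e |: Z) - entropy Z.
Proof.
rewrite entropy_step -(mean_cst 0); apply: ler_mean => w wA.
rewrite oppr_ge0 ln_le0// cprob_self ler_pdivrMr ?clsR_gt0// mul1r ler_nat.
apply/subset_leq_card/subsetP => v; rewrite !inE => /andP[-> /=].
exact/agreeS/subsetUr.
Qed.

Lemma entropy_step_le_ln Z e : entropy (e |: Z) - entropy Z <= ln q.+1%:R.
Proof.
have k0 : 0 < q.+1%:R^-1 :> R by rewrite invr_gt0.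
have := @gibbs Z [set e] (fun _ _ => q.+1%:R^-1) (fun _ _ _ _ => erefl)
  (fun _ _ => erefl) (fun _ _ => k0); rewrite setUC.
rewrite mean_cst lnV ?posrE// opprK.
have : mean (fun w => \sum_(y in restr [set e] @: cls Z w) q.+1%:R^-1) <= 1.
  rewrite -[leRHS]mean_cst; apply: ler_mean => w wA.
  have := @sum_restr_le [set e] (cls Z w) (fun _ _ => q.+1%:R^-1)
    (fun _ _ => ltW k0).
  rewrite [leRHS]big_set1 [leRHS]sumr_const card_ord -(mulr_natr _^-1) mulVf//.
  by apply: le_trans; apply: ler_sum => y _; rewrite big_set1.
lra.
Qed.

Lemma entropy0 : entropy set0 = 0.
Proof.
rewrite /entropy (eq_mean (g := fun=> ln #|A|%:R)) ?mean_cst ?subrr// => w wA.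
congr (ln _%:R); apply: eq_card => v; rewrite !inE andbC.
by rewrite (introT (agreeP _ _ _))// => e; rewrite inE.
Qed.

Lemma entropy_le_card P : entropy P <= #|P|%:R * ln q.+1%:R.
Proof.
have := @entropy_subadditive set0 P (fun=> set0) (fun _ _ => sub0set _).
rewrite set0U entropy0 subr0 => /le_trans; apply.
rewrite mulr_natl -sumr_const; apply: ler_sum => e _.
by have := entropy_step_le_ln set0 e; rewrite entropy0.
Qed.

Lemma entropy_determined P :
  (forall w v, w \in A -> v \in A -> agree P w v -> w = v) ->
  entropy P = ln #|A|%:R.
Proof.
move=> P1; rewrite /entropy (eq_mean (g := fun=> 0)) ?mean_cst ?subr0// => w wA.
rewrite (_ : cls P w = [set w]) ?cards1 ?ln1//.
apply/setP => v; rewrite !inE; apply/andP/eqP => [[vA /(P1 _ _ wA vA)]|->]//.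
by rewrite agreexx.
Qed.

Lemma entropy_ge_chain (Z Q : {set E}) (h : R) : [disjoint Z & Q] ->
    (forall e, e \in Q -> h <= entropy (Z :|: Q) - entropy ((Z :|: Q) :\ e)) ->
  #|Q|%:R * h <= entropy (Z :|: Q) - entropy Z.
Proof.
move=> ZQ hQ.
suff chain n (Q' : {set E}) : #|Q'| = n -> Q' \subset Q ->
    n%:R * h <= entropy (Z :|: Q') - entropy Z by exact: (chain _ Q).
elim: n Q' => [|n IH] Q' Q'n Q'Q.
  by rewrite (cards0_eq Q'n) setU0 mul0r subrr.
have /card_gt0P[e eQ'] : (0 < #|Q'|)%N by rewrite Q'n.
have eQ := subsetP Q'Q _ eQ'.
have eZ : e \notin Z by apply: contraL eQ => /(disjointFr ZQ) ->.
have := IH (Q' :\ e); rewrite (cardsD1 e) eQ' add1n in Q'n; case: Q'n => ->.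
move=> /(_ erefl (subset_trans (subD1set _ _) Q'Q)) IHe.
have := @entropy_submodular (Z :|: Q' :\ e) ((Z :|: Q) :\ e) e.
rewrite setD1K ?(subsetP (subsetUr _ _))//.
rewrite setUCA setD1K// => H.
have {}H : entropy (Z :|: Q) - entropy ((Z :|: Q) :\ e) <=
    entropy (Z :|: Q') - entropy (Z :|: Q' :\ e).
  apply: H; apply/subsetP => f; rewrite !inE => /orP[fZ|/andP[-> fQ']].
    by rewrite fZ andbT; apply: contraNneq eZ => <-.
  by rewrite (subsetP Q'Q _ fQ') orbT.
by have := hQ _ eQ; rewrite mulrSr; lra.
Qed.

Lemma entropy_imset (s : E -> E) (P : {set E}) : injective s ->
    (forall w, w \in A -> [ffun e => w (s e)] \in A) ->
  entropy (s @: P) = entropy P.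
Proof.
move=> s_inj sA; pose act (w : word) : word := [ffun e => w (s e)].
have act_inj : injective act.
  move=> w v /ffunP wv; apply/ffunP => e.
  by have := wv (invF s_inj e); rewrite !ffunE f_invF.
have actA : act @: A = A.
  apply/eqP; rewrite eqEcard (card_imset _ act_inj) leqnn andbT.
  by apply/subsetP => _ /imsetP[w wA ->]; apply: sA.
have reindex_act (F : word -> R) : \sum_(w in A) F w = \sum_(w in A) F (act w).
  by rewrite -{1}actA big_imset//= => w v _ _ /act_inj.
congr (_ - _ / _); rewrite [RHS]reindex_act; apply: eq_bigr => w wA; congr (ln _%:R).
rewrite -(card_imset _ act_inj); apply: eq_card => v; rewrite [RHS]inE -[in v \in A]actA.
have act_agree u : agree P (act w) (act u) = agree (s @: P) w u.
  apply/agreeP/agreeP => [wu _ /imsetP[e eP ->]|wu e eP].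
    by have := wu e eP; rewrite !ffunE.
  by rewrite !ffunE wu// imset_f.
apply/imsetP/andP => [[u]|[/imsetP[u uA ->]]].
  by rewrite inE => /andP[uA wu ->]; rewrite act_agree imset_f.
by rewrite act_agree => wu; exists u => //; rewrite inE uA.
Qed.
End Entropy.

(** * The extremal problem *)

Section Constants.
Variable R : realType.
Local Notation l2 := (ln 2 : R).
Local Notation l3 := (ln 3 : R).
Local Notation b := (beta R).

Lemma ln2_gt0 : 0 < l2. Proof. by rewrite ln_gt0// ltr1n. Qed.

Lemma ln2_le_ln3 : 3 * l2 <= 2 * l3.
Proof.
rewrite !mulr_natl -!lnXn// ler_ln ?posrE ?exprn_gt0//.
by rewrite -!natrX ler_nat.
Qed.

Lemma ln3_le_ln2 : 3 * l3 <= 5 * l2.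
Proof.
rewrite !mulr_natl -!lnXn// ler_ln ?posrE ?exprn_gt0//.
by rewrite -!natrX ler_nat.
Qed.

Lemma betaE : 2 * (b * l3) - b * l2 = l3.
Proof.
rewrite mulrCA -mulrBr /beta divfK// gt_eqF//.
by have := ln2_gt0; have := ln2_le_ln3; lra.
Qed.

Lemma beta_gt0 : 0 < b.
Proof.
rewrite /beta divr_gt0//; have := ln2_gt0; have := ln2_le_ln3; lra.
Qed.

Lemma beta_lt1 : b < 1.
Proof.
rewrite /beta ltr_pdivrMr ?mul1r;
by have := ln2_gt0; have := ln2_le_ln3; lra.
Qed.

Lemma beta_ln3_gammaE : 2 * (gamma R * l2) = b * l3.
Proof.
have l20 : l2 != 0 by rewrite gt_eqF// ln2_gt0.
rewrite /gamma; have -> : 2 * ((b ^+ 2 / 2 + b * (1 - b) * (l3 / l2)) * l2) =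
  b * (b * l2 + 2 * (1 - b) * l3) by field.
by congr (_ * _); have := betaE; lra.
Qed.

Lemma star_degree_constant : l2 + b * (l3 - l2) / 3 <= b * l3.
Proof.
have l20 := ln2_gt0; have l23 := ln2_le_ln3; have l32 := ln3_le_ln2.
have p : 0 < 2 * l3 - l2 by lra.
rewrite -(ler_pM2r p).
have -> : (l2 + b * (l3 - l2) / 3) * (2 * l3 - l2) =
  l2 * (2 * l3 - l2) + (l3 - l2) / 3 * (2 * (b * l3) - b * l2) by field.
have -> : b * l3 * (2 * l3 - l2) = (2 * (b * l3) - b * l2) * l3 by ring.
rewrite betaE; nra.
Qed.

Lemma sparse_degree_constant : l3 - l2 / 2 <= b * l3.
Proof.
have l20 := ln2_gt0; have l23 := ln2_le_ln3; have l32 := ln3_le_ln2.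
have p : 0 < 2 * l3 - l2 by lra.
rewrite -(ler_pM2r p).
have -> : b * l3 * (2 * l3 - l2) = (2 * (b * l3) - b * l2) * l3 by ring.
rewrite betaE; nra.
Qed.
End Constants.

Section Extremal.
Variables (R : realType) (V : finType).
Local Notation l2 := (ln 2 : R).
Local Notation l3 := (ln 3 : R).
Local Notation D := (beta R * ln 3 : R).

Definition locally_sparse (X : {set V}) (c : V -> V -> nat) :=
  forall x y z t, x \in X -> y \in X -> z \in X -> t \in X ->
    uniq [:: x; y; z; t] ->
    (c x y + c x z + c x t + c y z + c y t + c z t <= 9)%N.

Definition logdeg (c : V -> V -> nat) (X : {set V}) x : R :=
  \sum_(y in X) ln (c x y).+1%:R.

Variable c : V -> V -> nat.
Hypothesis c_sym : forall x y, c x y = c y x.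
Hypothesis c_irr : forall x, c x x = 0%N.

Lemma card_set3_le (x y z : V) : (#|[set x; y; z]| <= 3)%N.
Proof.
by rewrite (leq_trans (leq_card_setU _ _))// cards1 cards2; case: eqP.
Qed.

Lemma lnS_le3 q : (q <= 2)%N -> ln q.+1%:R <= l3.
Proof. by move=> q2; rewrite ler_ln ?posrE ?ltr0n// ler_nat ltnS. Qed.

Lemma ln_le_chord2 q : (q <= 2)%N -> ln q.+1%:R <= q%:R * l2.
Proof.
have := ln2_gt0 R; have := ln3_le_ln2 R.
by case: q => [|[|[|]]]// *; rewrite ?ln1; lra.
Qed.

Lemma ln_le_chord3 q : (q <= 2)%N -> ln q.+1%:R <= l2 + (l3 - l2) * (q%:R - 1).
Proof.
have := ln2_gt0 R; have := ln3_le_ln2 R.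
by case: q => [|[|[|]]]// *; rewrite ?ln1; lra.
Qed.

Lemma star_weight_le p q1 q2 q3 :
    (p <= 2)%N -> (q1 <= 2)%N -> (q2 <= 2)%N -> (q3 <= 2)%N ->
    (p + q1 + q2 <= 4)%N -> (p + q1 + q3 <= 4)%N -> (p + q2 + q3 <= 4)%N ->
  (1 - beta R) * ln p.+1%:R +
    beta R / 3 * (ln q1.+1%:R + ln q2.+1%:R + ln q3.+1%:R) <= D.
Proof.
move=> p2 q12 q22 q32 s12 s13 s23.
have l20 := ln2_gt0 R; have l23 := ln2_le_ln3 R.
have b0 := beta_gt0 R; have bE := betaE R; have sE := star_degree_constant R.
have b30 : 0 <= beta R / 3 by lra.
have qsum k : (2 * (q1 + q2 + q3) <= k.*2.+1)%N -> q1%:R + q2%:R + q3%:R <= k%:R :> R.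
  by move=> h; rewrite -!natrD ler_nat; move: h; clear; lia.
case: p p2 s12 s13 s23 => [|[|[|]]]// _ s12 s13 s23; rewrite ?ln1.
- have := lnS_le3 q12; have := lnS_le3 q22; have := lnS_le3 q32 => h3 h2 h1.
  have /(ler_wpM2l b30) : ln q1.+1%:R + ln q2.+1%:R + ln q3.+1%:R <= 3 * l3 by lra.
  by move=> h; lra.
- have := ln_le_chord3 q12; have := ln_le_chord3 q22; have := ln_le_chord3 q32.
  move=> h3 h2 h1; have hq : q1%:R + q2%:R + q3%:R <= 4%:R :> R.
    by apply: qsum; move: s12 s13 s23; clear; lia.
  have hl : 0 <= l3 - l2 by lra.
  have := ler_wpM2l hl hq => h.
  have /(ler_wpM2l b30) : ln q1.+1%:R + ln q2.+1%:R + ln q3.+1%:R <= 2 * l2 + l3.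
    lra.
  by move=> {h1 h2 h3 h hq}h; lra.
- have := ln_le_chord2 q12; have := ln_le_chord2 q22; have := ln_le_chord2 q32.
  move=> h3 h2 h1; have hq : q1%:R + q2%:R + q3%:R <= 3%:R :> R.
    by apply: qsum; move: s12 s13 s23; clear; lia.
  have := ler_wpM2r (ltW l20) hq => h.
  have /(ler_wpM2l b30) : ln q1.+1%:R + ln q2.+1%:R + ln q3.+1%:R <= 3 * l2 by lra.
  by move=> {h1 h2 h3 h hq}h; lra.
Qed.

Section SmallMultiplicities.
Hypothesis c_le2 : forall x y, (c x y <= 2)%N.

Lemma wt_le3 x y : ln (c x y).+1%:R <= l3.
Proof. exact: lnS_le3. Qed.

Lemma exists_le_average (X : {set V}) (I : finType) (f : I -> V) (p : I -> R) K :
    (forall i, f i \in X) -> (forall i, 0 <= p i) -> \sum_i p i = 1 ->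
    \sum_i p i * logdeg c X (f i) <= K ->
  exists2 x, x \in X & logdeg c X x <= K.
Proof.
move=> fX p0 p1 pK; apply: contrapT => noX.
have {}noX i : K < logdeg c X (f i).
  by rewrite ltNge; apply/negP => le; apply: noX; exists (f i).
suff : K < \sum_i p i * logdeg c X (f i) by rewrite ltNge pK.
rewrite -(mul1r K) -p1 mulr_suml lt_def.
have le : \sum_i p i * K <= \sum_i p i * logdeg c X (f i).
  by apply: ler_sum => i _; apply/ler_wpM2l/ltW.
rewrite le andbT -subr_eq0 -sumrB psumr_neq0//.
  apply/hasP; have [i pi|/= no] := pickP (fun i => p i != 0).
    exists i; rewrite ?mem_index_enum//= -mulrBr mulr_gt0// ?subr_gt0//.
    by rewrite lt_def pi p0.
  move: p1; rewrite big1 => [/esym/eqP|i _]; first by rewrite oner_eq0.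
  by have /negbFE/eqP := no i.
by move=> i _; rewrite -mulrBr mulr_ge0// subr_ge0 ltW.
Qed.

Lemma weighted_sum_le (X S : {set V}) (f : V -> R) (K M : R) :
    0 <= K -> 0 <= M -> (forall t, f t <= M) ->
    (forall t, t \in X -> t \notin S -> f t <= K) ->
  \sum_(t in X) f t <= #|X|%:R * K + #|S|%:R * M.
Proof.
move=> K0 M0 fM fK; rewrite (bigID (mem S))/= addrC lerD//.
  apply: le_trans (_ : \sum_(t in X | t \notin S) K <= _).
    by apply: ler_sum => t /andP[tX tS]; apply: fK.
  rewrite sumr_const -(mulr_natl K) ler_wpM2r// ler_nat.
  by apply/subset_leq_card/subsetP => t /andP[].
apply: le_trans (_ : \sum_(t in X | t \in S) M <= _).
  by apply: ler_sum => t _; apply: fM.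
rewrite sumr_const -(mulr_natl M) ler_wpM2r// ler_nat.
by apply/subset_leq_card/subsetP => t /andP[].
Qed.

Lemma low_degree_triangle X x y z : locally_sparse X c ->
    x \in X -> y \in X -> z \in X -> c x y = 2 -> c x z = 2 -> c y z = 2 ->
  exists2 v, v \in X & logdeg c X v <= #|X|%:R * D + 4 * l3.
Proof.
move=> Xc xX yX zX xy xz yz.
have l20 := ln2_gt0 R; have l23 := ln2_le_ln3 R; have l32 := ln3_le_ln2 R.
pose f (i : 'I_3) := nth x [:: x; y; z] i.
apply: (@exists_le_average X _ f (fun=> 3^-1)) => //.
- by move=> [[|[|[|]]]].
- by rewrite sumr_const card_ord -(mulr_natr _^-1) mulVf// pnatr_eq0.
rewrite !big_ord_recl big_ord0 /f/= addr0 /logdeg !mulr_sumr -!big_split/=.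
have neq u v : c u v = 2 -> u != v.
  by move=> uv; apply: contra_eq_neq uv => ->; rewrite c_irr.
apply: le_trans (@weighted_sum_le X [set x; y; z] _ l2 l3 _ _ _ _) _.
- lra.
- lra.
- by move=> t; have := wt_le3 x t; have := wt_le3 y t; have := wt_le3 z t; lra.
- move=> t tX; rewrite !inE !negb_or -!andbA => /and3P[tx ty tz].
  have /= := Xc x y z t xX yX zX tX; rewrite !inE.
  rewrite !negb_or (neq _ _ xy) (neq _ _ xz) (neq _ _ yz) !(eq_sym _ t) tx ty tz.
  move=> /(_ isT).
  rewrite xy xz yz => s9.
  have := ln_le_chord2 (c_le2 x t); have := ln_le_chord2 (c_le2 y t).
  have := ln_le_chord2 (c_le2 z t) => hz hy hx.
  have /(ler_wpM2r (ltW l20)) : (c x t)%:R + (c y t)%:R + (c z t)%:R <= 3%:R :> R.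
    by rewrite -!natrD ler_nat; move: s9; clear; lia.
  lra.
have : #|[set x; y; z]|%:R <= 3 :> R by rewrite ler_nat card_set3_le.
have l30 : 0 <= l3 by lra.
move=> /(ler_wpM2r l30) cS.
have aD : #|X|%:R * l2 <= #|X|%:R * D.
  rewrite ler_wpM2l//; apply: le_trans (star_degree_constant R).
  by rewrite lerDl divr_ge0// mulr_ge0 ?(ltW (beta_gt0 R))//; lra.
lra.
Qed.

Lemma low_degree_star X x y1 y2 y3 : locally_sparse X c ->
    x \in X -> y1 \in X -> y2 \in X -> y3 \in X ->
    c x y1 = 2 -> c x y2 = 2 -> c x y3 = 2 ->
    c y1 y2 = 1 -> c y1 y3 = 1 -> c y2 y3 = 1 ->
  exists2 v, v \in X & logdeg c X v <= #|X|%:R * D + 4 * l3.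
Proof.
move=> Xc xX y1X y2X y3X x1 x2 x3 y12 y13 y23.
have l20 := ln2_gt0 R; have l23 := ln2_le_ln3 R; have l32 := ln3_le_ln2 R.
have b0 := beta_gt0 R; have b1 := beta_lt1 R.
pose f (i : 'I_4) := nth x [:: x; y1; y2; y3] i.
pose p (i : 'I_4) := nth 0 [:: 1 - beta R; beta R / 3; beta R / 3; beta R / 3] i.
apply: (@exists_le_average X _ f p) => //.
- by move=> [[|[|[|[|]]]]].
- by move=> [[|[|[|[|]]]] i]//; rewrite /p/=; lra.
- by rewrite !big_ord_recl big_ord0 /p/=; lra.
rewrite !big_ord_recl big_ord0 /f /p /= addr0 /logdeg !mulr_sumr -!big_split/=.
have neq k u v : c u v = k.+1 -> u != v.
  by move=> uv; apply: contra_eq_neq uv => ->; rewrite c_irr.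
apply: le_trans (@weighted_sum_le X [set x; y1; y2; y3] _ D l3 _ _ _ _) _.
- by rewrite mulr_ge0//; lra.
- lra.
- move=> t; have := wt_le3 x t; have := wt_le3 y1 t; have := wt_le3 y2 t.
  have := wt_le3 y3 t => h3 h2 h1 hx.
  have b30 : 0 <= beta R / 3 by lra.
  have b10 : 0 <= 1 - beta R by lra.
  have := ler_wpM2l b10 hx; have := ler_wpM2l b30 h1.
  by have := ler_wpM2l b30 h2; have := ler_wpM2l b30 h3; lra.
- move=> t tX; rewrite !inE !negb_or -!andbA => /and4P[tx t1 t2 t3].
  have uniq4 y z : y \in X -> z \in X -> c x y = 2 -> c x z = 2 -> c y z = 1 ->
      t != y -> t != z -> (c x t + c y t + c z t <= 4)%N.
    move=> yX zX xy xz yz ty tz.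
    have /= := Xc x y z t xX yX zX tX; rewrite !inE.
    rewrite !negb_or (neq _ _ _ xy) (neq _ _ _ xz) (neq _ _ _ yz).
    by rewrite !(eq_sym _ t) tx ty tz => /(_ isT); rewrite xy xz yz; clear; lia.
  have := star_weight_le (c_le2 x t) (c_le2 y1 t) (c_le2 y2 t) (c_le2 y3 t)
    (uniq4 _ _ y1X y2X x1 x2 y12 t1 t2) (uniq4 _ _ y1X y3X x1 x3 y13 t1 t3)
    (uniq4 _ _ y2X y3X x2 x3 y23 t2 t3).
  by rewrite !mulrDr !addrA.
have : #|[set x; y1; y2; y3]|%:R <= 4 :> R.
  rewrite ler_nat (leq_trans (leq_card_setU _ _))// cards1 addn1 ltnS.
  exact: card_set3_le.
have l30 : 0 <= l3 by lra.
by move=> /(ler_wpM2r l30); lra.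
Qed.
Lemma sum_indicator (X : {set V}) (P : pred V) :
  \sum_(y in X) (P y)%:R = #|[set y in X | P y]|%:R :> R.
Proof.
rewrite -sum1_card natr_sum big_mkcond [RHS]big_mkcond; apply: eq_bigr => y _.
by rewrite !inE; case: (y \in X) => //; case: (P y).
Qed.

Lemma triangle_free_low_degree (N : {set V}) (e : rel V) : N != set0 ->
    (forall x y z, x \in N -> y \in N -> z \in N -> e x y -> e x z -> ~~ e y z) ->
    symmetric e ->
  exists2 u, u \in N & (#|[set v in N | e u v]|.*2 <= #|N|)%N.
Proof.
move=> /set0Pn[x0 x0N] tri e_sym.
have [[x [y [xN yN xy]]]|noe] := pselect (exists x y, [/\ x \in N, y \in N & e x y]).
  have dis : [disjoint [set v in N | e x v] & [set v in N | e y v]].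
    apply/pred0P => v /=; rewrite !inE; apply/negP.
    move=> /andP[/andP[vN xv] /andP[_ yv]].
    by have := tri x y v xN yN vN xy xv; rewrite yv.
  have : (#|[set v in N | e x v]| + #|[set v in N | e y v]| <= #|N|)%N.
    rewrite -(leq_card_setU _ _).2 in dis.
    rewrite -(eqP dis); apply/subset_leq_card/subsetP => v; rewrite !inE.
    by case/orP => /andP[].
  case: (leqP #|[set v in N | e x v]|.*2 #|N|) => [? _|]; first by exists x.
  by move=> h1 h2; exists y => //; move: h1 h2; clear; lia.
exists x0 => //; rewrite (_ : [set v in N | _] = set0) ?cards0//.
apply/setP => v; rewrite !inE; apply/negP => /andP[vN x0v].
by apply: noe; exists x0, v.
Qed.

Lemma low_degree_sparse X : X != set0 ->
    (forall x y z, x \in X -> y \in X -> z \in X ->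
       c x y = 2 -> c x z = 2 -> c y z <> 2) ->
    (forall x y1 y2 y3, x \in X -> y1 \in X -> y2 \in X -> y3 \in X ->
       c x y1 = 2 -> c x y2 = 2 -> c x y3 = 2 ->
       c y1 y2 = 1 -> c y1 y3 = 1 -> c y2 y3 <> 1) ->
  exists2 v, v \in X & logdeg c X v <= #|X|%:R * D.
Proof.
move=> /set0Pn[x0 x0X] notri nostar.
have l20 := ln2_gt0 R; have l23 := ln2_le_ln3 R; have l32 := ln3_le_ln2 R.
have sD := sparse_degree_constant R.
pose N x := [set y in X | c x y == 2].
have [b bX bmax] := @arg_maxnP V x0 (mem X) (fun x => #|N x|) x0X.
have NX : #|N b|%:R <= #|X|%:R :> R.
  by rewrite ler_nat; apply/subset_leq_card/subsetP => y; rewrite inE => /andP[].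
have [N0|N0] := eqVneq (N b) set0.
  exists b => //; apply: (@le_trans _ _ (\sum_(y in X) l2)).
    apply: ler_sum => y yX; have : y \notin N b by rewrite N0 inE.
    rewrite inE yX /=; have := c_le2 b y; have := ln2_gt0 R.
    by case: (c b y) => [|[|[|]]]// _ _ _; rewrite ?ln1//; lra.
  rewrite sumr_const -(mulr_natl l2) ler_wpM2l//; lra.
have NbX y : y \in N b -> y \in X /\ c b y = 2 by rewrite inE => /andP[? /eqP].
have [||u uN u1] := @triangle_free_low_degree (N b) (fun x y => c x y == 1) N0.
- move=> x y z /NbX[xX bx] /NbX[yX by'] /NbX[zX bz] /eqP xy /eqP xz.
  by apply/eqP; apply: (nostar b x y z).
- by move=> x y; rewrite c_sym.
have [uX bu] := NbX u uN.
exists u => //; pose e1 : R := #|[set v in N b | c u v == 1]|%:R.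
have e1N : 2 * e1 <= #|N b|%:R by rewrite -natrM ler_nat mul2n.
apply: (@le_trans _ _ (#|X|%:R * l2 + (l3 - l2) * #|N u|%:R
    - l2 * #|N b|%:R + l2 * e1)); last first.
  have : #|N u|%:R <= #|N b|%:R :> R by rewrite ler_nat; apply: bmax.
  have d0 : 0 <= l3 - l2 by lra.
  move=> /(ler_wpM2l d0) h1; have h2 := ler_wpM2l (ltW l20) e1N.
  have d1 : 0 <= l3 - 3 / 2 * l2 by lra.
  have := ler_wpM2l d1 NX => h3.
  have := ler_wpM2l (ler0n R #|X|) sD; lra.
have -> : #|N b|%:R = \sum_(y in X) (y \in N b)%:R :> R.
  rewrite sum_indicator; congr _%:R; apply: eq_card => y; rewrite !inE.
  by rewrite andbA andbb.
have -> : e1 = \sum_(y in X) ((y \in N b) && (c u y == 1))%:R :> R.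
  rewrite sum_indicator; congr _%:R; apply: eq_card => y; rewrite !inE.
  by rewrite !andbA andbb.
rewrite -sum_indicator !mulr_sumr mulr_natl -sumr_const -sumrN -!big_split/=.
apply: ler_sum => y yX; case: (boolP (y \in N b)) => [/NbX[_ yb]|_] /=.
  have := notri b u y bX uX yX bu yb; have := c_le2 u y.
  by case: (c u y) => [|[|[|]]]//= _ _; rewrite ?ln1; lra.
have := c_le2 u y.
by case: (c u y) => [|[|[|]]]//= _; rewrite ?ln1; lra.
Qed.

Lemma low_degree X : locally_sparse X c -> X != set0 ->
  exists2 v, v \in X & logdeg c X v <= #|X|%:R * D + 4 * l3.
Proof.
move=> Xc X0.
have l30 : 0 <= 4 * l3 by rewrite mulr_ge0// ln_ge0// ler1n.
have [[x [y [z [[xX yX zX] [xy xz yz]]]]]|notri] := pselect (exists x y z,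
    [/\ x \in X, y \in X & z \in X] /\ [/\ c x y = 2, c x z = 2 & c y z = 2]).
  exact: low_degree_triangle xy xz yz.
have [[x [y1 [y2 [y3 [[xX X1 X2 X3] [[x1 x2 x3] [y12 y13 y23]]]]]]]|nostar] :=
  pselect (exists x y1 y2 y3, [/\ x \in X, y1 \in X, y2 \in X & y3 \in X] /\
    [/\ c x y1 = 2, c x y2 = 2 & c x y3 = 2] /\
    [/\ c y1 y2 = 1, c y1 y3 = 1 & c y2 y3 = 1]).
  exact: low_degree_star x1 x2 x3 y12 y13 y23.
have [x y z xX yX zX xy xz yz|x y1 y2 y3 xX X1 X2 X3 x1 x2 x3 y12 y13 y23|v vX vD] :=
  low_degree_sparse X0.
- by apply: notri; exists x, y, z.
- by apply: nostar; exists x, y1, y2, y3.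
- by exists v => //; apply: (le_trans vD); rewrite lerDl.
Qed.

Lemma logdeg_total_le X : locally_sparse X c ->
  \sum_(x in X) logdeg c X x <= #|X|%:R ^+ 2 * D + 9 * l3 * #|X|%:R.
Proof.
have D1 : D <= l3 by rewrite ler_piMl ?(ltW (beta_lt1 R))// ln_ge0// ler1n.
move: {2}#|X| (erefl #|X|) => n; elim: n X => [|n IH] X Xn Xc.
  by rewrite (cards0_eq Xn) big_set0 cards0 mulr0 expr0n/= mul0r addr0.
have [|v vX vD] := low_degree Xc; first by rewrite -card_gt0 Xn.
have XvE : X = v |: X :\ v by rewrite setD1K.
have vXv : v \notin X :\ v by rewrite !inE eqxx.
have Xvn : #|X :\ v| = n by move: Xn; rewrite (cardsD1 v) vX add1n => -[].
have Xvc : locally_sparse (X :\ v) c.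
  by move=> x y z t /setD1P[_ xX] /setD1P[_ yX] /setD1P[_ zX] /setD1P[_ tX]; apply: Xc.
have := IH _ Xvn Xvc.
rewrite (big_setD1 v vX)/= => IHn.
rewrite (eq_bigr (fun x => ln (c x v).+1%:R + logdeg c (X :\ v) x)).
  rewrite big_split/= (_ : \sum_(x in X :\ v) ln (c x v).+1%:R = logdeg c X v).
    by move: vD IHn; rewrite Xn Xvn -natr1; lra.
  rewrite /logdeg (big_setD1 v vX)/= c_irr ln1 add0r.
  by apply: eq_bigr => x _; rewrite c_sym.
by move=> x xX; rewrite /logdeg (big_setD1 v vX).
Qed.

End SmallMultiplicities.
End Extremal.

Section Heavy.
Variables (R : realType) (V : finType) (c : V -> V -> nat).
Hypothesis c_sym : forall x y, c x y = c y x.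
Hypothesis c_irr : forall x, c x x = 0%N.
Variable X : {set V}.
Hypothesis Xc : locally_sparse X c.

Let heavy x y := (2 < c x y)%N.

Lemma heavy_codegree y z : y \in X -> z \in X -> y != z ->
  (\sum_(x in X) heavy x y * heavy x z <= 1)%N.
Proof.
move=> yX zX yz.
rewrite (_ : (\sum_(x in X) _)%N = #|[set x in X | heavy x y && heavy x z]|).
  apply/card_le1_eqP => u v; rewrite !inE => /and3P[uX uy uz] /and3P[vX vy vz].
  apply/eqP; apply/negPn/negP => vu.
  have neq x t : heavy x t -> x != t.
    by apply: contraTneq => ->; rewrite /heavy c_irr.
  have /= := Xc uX vX yX zX; rewrite !inE !negb_or (eq_sym u v) vu yz.
  rewrite (neq _ _ uy) (neq _ _ uz) (neq _ _ vy) (neq _ _ vz) => /(_ isT).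
  by move: uy uz vy vz; rewrite /heavy; clear; lia.
rewrite -sum1_card big_mkcond [RHS]big_mkcond; apply: eq_bigr => x _.
by rewrite inE; case: (x \in X) => //; case: (heavy x y); case: (heavy x z).
Qed.

Lemma sum_heavy_sqr_le :
  (\sum_(x in X) (\sum_(y in X) heavy x y) ^ 2 <= 2 * #|X| ^ 2)%N.
Proof.
have -> : (\sum_(x in X) (\sum_(y in X) heavy x y) ^ 2 =
    \sum_(y in X) \sum_(z in X) \sum_(x in X) heavy x y * heavy x z)%N.
  rewrite (eq_bigr (fun x => \sum_(y in X) \sum_(z in X) heavy x y * heavy x z)%N).
    by rewrite exchange_big; apply: eq_bigr => y _; rewrite exchange_big.
  by move=> x _; rewrite -mulnn big_distrlr.
apply: (@leq_trans (\sum_(y in X) 2 * #|X|)); last first.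
  by rewrite sum_nat_const -mulnn; lia.
apply: leq_sum => y yX; rewrite (big_setD1 y)//= mul2n -addnn leq_add//.
  rewrite -sum1_card; apply: leq_sum => x _.
  by case: (heavy x y).
apply: (@leq_trans (\sum_(z in X :\ y) 1)).
  by apply: leq_sum => z /setD1P[zy zX]; apply: heavy_codegree; rewrite // eq_sym.
by rewrite sum1_card subset_leq_card// subD1set.
Qed.

(* Two vertices have at most one common heavy neighbour, so heavy pairs are
   sparse, as in the Kővári–Sós–Turán bound for K_{2,2}. *)
Lemma sum_heavy_le (l : R) : 0 < l ->
  \sum_(x in X) \sum_(y in X) (heavy x y)%:R <=
  l * #|X|%:R + 2 * #|X|%:R ^+ 2 / l.
Proof.
move=> l0; pose d x : R := \sum_(y in X) (heavy x y)%:R.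
have dl x : d x <= l + (d x) ^+ 2 / l.
  have [dl|ld] := leP (d x) l; first by rewrite ler_wpDr// divr_ge0// ?sqr_ge0// ltW.
  rewrite ler_wpDl ?(ltW l0)// ler_pdivlMr// expr2 ler_wpM2l ?(ltW ld)//.
  by rewrite sumr_ge0.
apply: le_trans (_ : \sum_(x in X) (l + (d x) ^+ 2 / l) <= _).
  by apply: ler_sum => x _; apply: dl.
rewrite big_split/= sumr_const -(mulr_natr l) lerD2l -mulr_suml ler_pM2r ?invr_gt0//.
have := sum_heavy_sqr_le; rewrite -(ler_nat R) natrM natrX; apply: le_trans.
by rewrite natr_sum; apply: ler_sum => x _; rewrite /d natrX natr_sum.
Qed.

Hypothesis c_le9 : forall x y, (c x y <= 9)%N.

Lemma logdeg_total_le_heavy (l : R) : 0 < l ->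
  \sum_(x in X) logdeg R c X x <=
  #|X|%:R ^+ 2 * (beta R * ln 3) + 9 * ln 3 * #|X|%:R +
  ln 10 * (l * #|X|%:R + 2 * #|X|%:R ^+ 2 / l).
Proof.
move=> l0; pose c' x y := if (c x y <= 2)%N then c x y else 0%N.
have c's x y : c' x y = c' y x by rewrite /c' c_sym.
have c'i x : c' x x = 0%N by rewrite /c' c_irr.
have c'2 x y : (c' x y <= 2)%N by rewrite /c'; case: ifP.
have c'c x y : (c' x y <= c x y)%N by rewrite /c'; case: ifP.
have c'X : locally_sparse X c'.
  move=> x y z t xX yX zX tX u; apply: leq_trans (Xc xX yX zX tX u).
  by rewrite !leq_add.
have L0 : 0 <= ln 10 :> R by rewrite ln_ge0// ler1n.
apply: le_trans (lerD (@logdeg_total_le R V c' c's c'i c'2 X c'X)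
  (ler_wpM2l L0 (sum_heavy_le l0))).
rewrite mulr_sumr -big_split/=; apply: ler_sum => x _.
rewrite mulr_sumr -big_split/=; apply: ler_sum => y _.
rewrite /c' /heavy leqNgt; case: ltnP => _ /=; last by rewrite mulr0 addr0.
by rewrite ln1 add0r mulr1 ler_ln ?posrE ?ltr0n// ler_nat ltnS.
Qed.

End Heavy.

Lemma logdeg_total_asymptotic (R : realType) (e : R) : 0 < e ->
  exists M : nat, forall (V : finType) (c : V -> V -> nat) (X : {set V}),
    (forall x y, c x y = c y x) -> (forall x, c x x = 0%N) ->
    (forall x y, c x y <= 9)%N -> locally_sparse X c -> (M <= #|X|)%N ->
  \sum_(x in X) logdeg R c X x <= (beta R * ln 3 + e) * #|X|%:R ^+ 2.
Proof.
move=> e0; have L0 : 0 < ln 10 :> R by rewrite ln_gt0// ltr1n.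
have l30 : 0 < ln 3 :> R by rewrite ln_gt0// ltr1n.
pose l := 4 * ln 10 / e; have l0 : 0 < l by rewrite divr_gt0// mulr_gt0.
pose K := 2 * (9 * ln 3 + ln 10 * l) / e.
have K0 : 0 <= K.
  by rewrite divr_ge0 ?(ltW e0)// mulr_ge0// addr_ge0// mulr_ge0// ltW.
exists (Num.bound K) => V c X cs ci c9 Xc KX.
apply: le_trans (logdeg_total_le_heavy cs ci Xc c9 l0) _.
have KX' : K <= #|X|%:R.
  by apply/ltW/(lt_le_trans (archi_boundP K0)); rewrite ler_nat.
have lE : ln 10 * (2 * #|X|%:R ^+ 2 / l) = e / 2 * #|X|%:R ^+ 2.
  by rewrite /l; field; rewrite !gt_eqF.
have KE : 9 * ln 3 + ln 10 * l = e / 2 * K by rewrite /K; field; rewrite gt_eqF.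
have : e / 2 * K * #|X|%:R <= e / 2 * #|X|%:R * #|X|%:R.
  by rewrite ler_wpM2r// ler_wpM2l// divr_ge0// ltW.
by rewrite -KE (mulrDr (ln 10)) lE; lra.
Qed.

(** * Exchangeability and the upper bound *)

Section Edges.
Variable V : finType.

Definition edges (X : {set V}) : {set {set V}} :=
  [set e : {set V} | (e \subset X) && (#|e| == 2)].

Lemma edges_set2 (X : {set V}) x y : x != y ->
  ([set x; y] \in edges X) = (x \in X) && (y \in X).
Proof. by move=> xy; rewrite inE cards2 xy andbT subUset !sub1set. Qed.

Lemma edgesP (X e : {set V}) : reflect
  (exists x y, [/\ x != y, x \in X, y \in X & e = [set x; y]]) (e \in edges X).
Proof.
apply: (iffP idP) => [|[x [y [xy xX yX ->]]]]; last by rewrite edges_set2// xX.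
move=> eX; move: (eX); rewrite inE => /andP[_ /cards2P[x [y [xy eE]]]].
by exists x, y; move: eX; rewrite eE edges_set2// => /andP[].
Qed.

Lemma edgesS (X Y : {set V}) : X \subset Y -> edges X \subset edges Y.
Proof.
move=> XY; apply/subsetP => e; rewrite !inE => /andP[eX ->].
by rewrite (subset_trans eX).
Qed.

Lemma card_edges X : #|edges X| = 'C(#|X|, 2).
Proof. exact: cards_draws. Qed.

Lemma sum_ordered_pairs (M : nmodType) (f : {set V} -> M) (X : {set V}) :
  \sum_(x in X) \sum_(y in X | x != y) f [set x; y] =
  (\sum_(e in edges X) f e) *+ 2.
Proof.
rewrite pair_big_dep/=.
rewrite (partition_big (fun p => [set p.1; p.2]) (mem (edges X)))/=; last first.
  by move=> [x y] /= /and3P[xX yX xy]; rewrite edges_set2// xX.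
rewrite -sumrMnl; apply: eq_bigr => _ /edgesP[a [b [ab aX bX ->]]].
rewrite (eq_bigl (mem [set (a, b); (b, a)])); last first.
  move=> [x y] /=; rewrite !inE !xpair_eqE.
  apply/andP/orP => [[/and3P[xX yX xy] /eqP E]|[] /andP[/eqP -> /eqP ->]].
  - have : x \in [set a; b] by rewrite -E set21.
    have : y \in [set a; b] by rewrite -E set22.
    move: xy; rewrite !inE => xy /orP[]/eqP yE /orP[]/eqP xE;
      move: xy; rewrite xE yE ?eqxx//= => _; by [right|left].
  - by rewrite aX bX ab eqxx.
  - by rewrite aX bX eq_sym ab setUC eqxx.
rewrite big_setU1/= ?big_set1/= ?mulr2n; last first.
  by rewrite inE xpair_eqE (negbTE ab).
by rewrite (setUC [set b]).
Qed.

Lemma sum_edges4 (f : {set V} -> nat) x y z t : uniq [:: x; y; z; t] ->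
  (\sum_(e in edges [set v in [:: x; y; z; t]]) f e =
  f [set x; y] + f [set x; z] + f [set x; t] +
  f [set y; z] + f [set y; t] + f [set z; t])%N.
Proof.
move=> u; have := sum_ordered_pairs f [set v in [:: x; y; z; t]].
have sumE (F : pred V) (G : V -> nat) :
    (\sum_(v in [set v in [:: x; y; z; t]] | F v) G v =
     \sum_(v <- [:: x; y; z; t] | F v) G v)%N.
  rewrite big_mkcondr [RHS]big_mkcond big_uniq//=.
  by apply: eq_bigl => v; rewrite inE.
rewrite (eq_bigr (fun v => \sum_(w <- [:: x; y; z; t] | v != w) f [set v; w])%N);
  last by move=> v _; rewrite sumE.
rewrite (eq_bigl (fun v => (v \in [set v in [:: x; y; z; t]]) && predT v)); last first.
  by move=> v; rewrite andbT.
rewrite sumE; move: u; rewrite /= !inE !negb_or -!andbA.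
move=> /and5P[xy xz xt yz /and3P[yt zt _]].
rewrite !big_cons !big_nil !eqxx/= xy xz xt yz yt zt.
rewrite !(eq_sym _ x) !(eq_sym t) xy xz xt yt zt (eq_sym z) yz/=.
rewrite (setUC [set y] [set x]) (setUC [set z] [set x]) (setUC [set t] [set x]).
rewrite (setUC [set z] [set y]) (setUC [set t] [set y]) (setUC [set t] [set z]).
set s := (\sum_(e in _) _)%N => H.
have : (s + s)%N = (s *+ 2)%R by [].
rewrite -{}H /GRing.add/=; clear; lia.
Qed.

Lemma edges_move (X X' e e' : {set V}) : #|X| = #|X'| -> e \in edges X ->
  e' \in edges X' ->
  exists s : V -> V, [/\ injective s, s @: X = X' & s @: e = e'].
Proof.
rewrite !inE => XX' /andP[eX /eqP e2] /andP[eX' /eqP e2'].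
pose l (X e : {set V}) := enum e ++ enum (X :\: e) ++ enum (~: X).
have l_mem (Y f : {set V}) v : f \subset Y -> v \in l Y f.
  move=> fY; rewrite !mem_cat !mem_enum !inE; case: (v \in Y); case: (v \in f) => //.
have l_size (Y f : {set V}) : f \subset Y -> size (l Y f) = #|V|.
  move=> fY; rewrite !size_cat -!cardE cardsD (setIidPr fY) -(cardsC Y).
  by have := subset_leq_card fY; lia.
have l_uniq (Y f : {set V}) : f \subset Y -> uniq (l Y f).
  move=> fY; rewrite /l -(eq_uniq (_ : size (enum V) = _) (_ : enum V =i _)).
  - by rewrite enum_uniq.
  - by rewrite l_size// -cardE.
  - by move=> v; rewrite l_mem// mem_enum.
pose s v := nth v (l X' e') (index v (l X e)).
have index_lt v : (index v (l X e) < size (l X' e'))%N.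
  by rewrite l_size// -(l_size X e)// index_mem l_mem.
have s_inj : injective s.
  move=> u v; rewrite /s (set_nth_default v u)// => /eqP; rewrite nth_uniq ?l_uniq//.
  by move=> /eqP/(congr1 (nth u (l X e))); rewrite !nth_index ?l_mem.
have s_im (P P' : {set V}) p q p' q' : l X e = p ++ q -> l X' e' = p' ++ q' ->
    p =i P -> p' =i P' -> size p = size p' -> #|P| = #|P'| -> s @: P = P'.
  move=> lE lE' pP p'P' pp' PP'; apply/eqP.
  rewrite eqEcard card_imset// PP' leqnn andbT; apply/subsetP => _ /imsetP[v vP ->].
  rewrite -p'P' /s lE lE' index_cat pP vP nth_cat -pp' index_mem pP vP.
  by rewrite mem_nth// -pp' index_mem pP.
exists s; split => //.
  have cat_mem (Y f : {set V}) : f \subset Y -> enum f ++ enum (Y :\: f) =i Y.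
    move=> /subsetP fY v; rewrite mem_cat !mem_enum inE.
    by case: (boolP (v \in f)) => // /fY ->.
  apply: (s_im _ _ _ _ _ _ (catA _ _ _) (catA _ _ _) (cat_mem _ _ eX)
    (cat_mem _ _ eX') _ XX').
  by rewrite !size_cat -!cardE !cardsD (setIidPr eX) (setIidPr eX') e2 e2' XX'.
apply: (s_im _ _ _ _ _ _ erefl erefl); rewrite -?cardE ?e2 ?e2'// => v;
  by rewrite mem_enum.
Qed.
End Edges.

Section Words.
Variables (R : realType) (n : nat).
Local Notation V := 'I_n.
Local Notation word := {ffun {set V} -> 'I_10}.

(* Multigraphs on V as words indexed by all subsets of V, with letter 0 off the
   pairs: permutations of V then act by taking images of subsets. *)
Definition sparse_words : {set word} :=
  [set w : word | [forall e, (e \notin edges [set: V]) ==> (w e == ord0)] &&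
    [forall X : {set V}, (#|X| == 4) ==> (\sum_(e in edges X) w e <= 9)%N]].

Definition mult (w : word) (x y : V) : nat := w [set x; y].

Local Notation A := sparse_words.
Local Notation H := (entropy R A).

Lemma sparse_wordsP (w : word) : reflect
  ((forall e, e \notin edges [set: V] -> w e = ord0) /\
   (forall X : {set V}, #|X| = 4 -> (\sum_(e in edges X) w e <= 9)%N))
  (w \in A).
Proof.
rewrite inE; apply: (iffP andP) => -[w0 w9]; split.
- by move=> e eT; apply/eqP; move/forallP: w0 => /(_ e); rewrite eT.
- by move=> X X4; move/forallP: w9 => /(_ X); rewrite X4.
- by apply/forallP => e; apply/implyP => eT; rewrite w0.
- by apply/forallP => X; apply/implyP => /eqP X4; apply: w9.
Qed.

Lemma locally_sparse_mult (w : word) (X : {set V}) : w \in A -> locally_sparse X (mult w).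
Proof.
move=> /sparse_wordsP[_ w9] x y z t _ _ _ _ u.
rewrite -(@sum_edges4 V (fun e => nat_of_ord (w e)))//; apply: w9.
by rewrite cardsE; apply/card_uniqP.
Qed.

Lemma sparse_words_gt0 : (0 < #|A|)%N.
Proof.
apply/card_gt0P; exists [ffun=> ord0]; apply/sparse_wordsP; split=> [e _|X _].
  by rewrite ffunE.
by rewrite big1// => e _; rewrite ffunE.
Qed.
Let A0 := sparse_words_gt0.

Lemma edges_imset (s : V -> V) (X : {set V}) : injective s ->
  (fun e : {set V} => s @: e) @: edges X = edges (s @: X).
Proof.
move=> s_inj; apply/setP => e; apply/imsetP/edgesP.
  move=> [_ /edgesP[x [y [xy xX yX ->]]] ->]; exists (s x), (s y).
  by rewrite (inj_eq s_inj) !imset_f//; split => //; rewrite imsetU !imset_set1.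
move=> [u [v [xy /imsetP[x xX xE] /imsetP[y yX yE] ->]]]; subst.
exists [set x; y]; last by rewrite imsetU !imset_set1.
by rewrite edges_set2 ?xX//; apply: contraNneq xy => ->.
Qed.

Lemma sparse_words_move (s : V -> V) (w : word) : injective s -> w \in A ->
  [ffun e : {set V} => w (s @: e)] \in A.
Proof.
move=> s_inj /sparse_wordsP[w0 w9]; have s2_inj := imset_inj s_inj.
apply/sparse_wordsP; split=> [e|X X4].
  rewrite ffunE => eT; apply: w0; apply: contra eT.
  by rewrite !inE !subsetT card_imset.
rewrite (eq_bigr (fun e : {set V} => nat_of_ord (w (s @: e)))); last first.
  by move=> e _; rewrite ffunE.
rewrite -(big_imset (fun e => nat_of_ord (w e)) (in2W s2_inj)) edges_imset//.
by apply: w9; rewrite card_imset.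
Qed.

Definition cond_entropy (X e : {set V}) : R := H (edges X) - H (edges X :\ e).

Definition init (j : nat) : {set V} := [set i : V | (i < j)%N].

Definition edge_entropy (j : nat) : R := cond_entropy (init j) (init 2).
Local Notation h := edge_entropy.

Lemma card_init j : (j <= n)%N -> #|init j| = j.
Proof.
move=> jn; rewrite -sum1_card (eq_bigl (fun i : V => (i < j)%N)); last first.
  by move=> i; rewrite inE.
by rewrite -(big_ord_widen n (fun=> 1)%N jn) sum1_card card_ord.
Qed.

Lemma init_edge j : (2 <= j <= n)%N -> init 2 \in edges (init j).
Proof.
move=> /andP[j2 jn]; rewrite inE card_init ?(leq_trans j2)// eqxx andbT.
by apply/subsetP => i; rewrite !inE => /leq_trans; apply.
Qed.

Lemma cond_entropyE (X e : {set V}) : e \in edges X -> cond_entropy X e = h #|X|.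
Proof.
move=> eX; have Xn : (#|X| <= n)%N by rewrite -[leqRHS]card_ord max_card.
have X2 : (2 <= #|X|)%N.
  by move: eX; rewrite inE => /andP[/subset_leq_card + /eqP e2]; rewrite e2.
have iX : init 2 \in edges (init #|X|) by rewrite init_edge// X2.
have [s [s_inj sX se]] := edges_move (esym (card_init Xn)) eX iX.
have s2_inj := imset_inj s_inj.
rewrite /h /cond_entropy -sX -se.
have -> : edges (s @: X) :\ (s @: e) = (fun f : {set V} => s @: f) @: (edges X :\ e).
  rewrite -edges_imset//; apply/setP => f; rewrite inE in_set1; apply/andP/imsetP.
    move=> [fe /imsetP[g gX fE]]; exists g; rewrite // in_setD1 gX andbT.
    by apply: contraNneq fe => <-; rewrite fE.
  move=> [g /setD1P[ge gX] ->]; split; last exact: imset_f.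
  by rewrite (inj_eq s2_inj).
rewrite -edges_imset//.
rewrite !(@entropy_imset R _ _ A _ _ s2_inj)// => w; exact: sparse_words_move.
Qed.

Lemma cond_entropyS (X Y e : {set V}) : X \subset Y -> e \in edges X ->
  cond_entropy Y e <= cond_entropy X e.
Proof.
move=> XY eX; have eY := subsetP (edgesS XY) _ eX.
have := @entropy_submodular R _ _ A A0 (edges X :\ e) (edges Y :\ e) e.
by rewrite !setD1K//; apply; apply/setSD/edgesS.
Qed.

Lemma edge_entropy_le i j : (2 <= i <= j)%N -> (j <= n)%N -> h j <= h i.
Proof.
move=> /andP[i2 ij] jn; apply: cond_entropyS.
  by apply/subsetP => x; rewrite !inE => /leq_trans; apply.
by rewrite init_edge// i2 (leq_trans ij).
Qed.

Lemma edge_entropy_ge0 j : (2 <= j <= n)%N -> 0 <= h j.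
Proof.
move=> jn; have := @entropy_step_ge0 R _ _ A A0 (edges (init j) :\ init 2) (init 2).
by rewrite setD1K// init_edge.
Qed.

Lemma edge_entropy_le_ln10 j : (2 <= j <= n)%N -> h j <= ln 10.
Proof.
move=> jn; have := @entropy_step_le_ln R _ _ A A0 (edges (init j) :\ init 2) (init 2).
by rewrite setD1K// init_edge.
Qed.

End Words.

Section Core.
Variables (R : realType) (n : nat).
Local Notation V := 'I_n.
Local Notation word := {ffun {set V} -> 'I_10}.
Local Notation A := (sparse_words n).
Local Notation H := (entropy R A).
Local Notation h := (edge_entropy R n).
Let A0 := sparse_words_gt0 n.

Section Sample.
Variables (S Y : {set V}).
Hypothesis disSY : [disjoint S & Y].
Local Notation Z := (edges (S :|: Y) :\: edges Y).
Local Notation Ze e := (edges (S :|: e) :\ e).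

Lemma edge_sub e : e \in edges Y -> e \subset Y /\ #|e| = 2.
Proof. by rewrite inE => /andP[? /eqP]. Qed.

Lemma edge_self e : e \in edges Y -> e \in edges (S :|: e).
Proof. by rewrite !inE subsetUr => /andP[_ ->]. Qed.

Lemma edge_sample_sub e : e \in edges Y -> Ze e \subset Z.
Proof.
move=> /edge_sub[eY e2]; apply/subsetP => f /setD1P[fe].
rewrite in_setD => fS; rewrite (subsetP (edgesS (setUS S eY)) _ fS) andbT.
apply: contra fe => /[dup]; rewrite {1}inE => /andP[fY /eqP f2] _.
rewrite eqEcard e2 f2 leqnn andbT; apply/subsetP => x xf.
move: fS; rewrite inE => /andP[/subsetP/(_ x xf) + _].
by rewrite inE => /orP[/(disjointFr disSY)|//]; rewrite (subsetP fY).
Qed.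

Lemma card_sample_edge e : e \in edges Y -> #|S :|: e| = (#|S| + 2)%N.
Proof.
move=> /edge_sub[eY e2]; rewrite cardsU e2 (_ : S :&: e = set0) ?cards0 ?subn0//.
by apply/disjoint_setI0/(disjointWr eY).
Qed.

Lemma edge_entropyE e : e \in edges Y -> H (e |: Ze e) - H (Ze e) = h (#|S| + 2).
Proof.
move=> eY; rewrite setD1K ?edge_self// -(card_sample_edge eY).
exact/cond_entropyE/edge_self.
Qed.

Lemma sample_edgesE : Z :|: edges Y = edges (S :|: Y).
Proof.
apply/setP => e; rewrite !(in_setU, in_setD) orb_andl orNb /=.
by apply/orP/idP => [[//|/(subsetP (edgesS (subsetUr _ _)))]|]; [|left].
Qed.

Variables (t : R).
Hypothesis t_bound : 0 < t <= 1 / 4.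

Let t0 : 0 < t. Proof. by case/andP: t_bound. Qed.

Definition top_mult (w : word) (e : {set V}) : 'I_10 :=
  inord (\max_(a : 'I_10 | t ^+ 2 <= cprob R A (Ze e) e w a) a).

Lemma val_top_mult w e :
  top_mult w e = \max_(a : 'I_10 | t ^+ 2 <= cprob R A (Ze e) e w a) a :> nat.
Proof.
rewrite inordK// (@leq_ltn_trans 9)//.
by apply/bigmax_leqP => a _; rewrite -ltnS.
Qed.

Lemma cprob_gt_top_mult w e (a : 'I_10) : (top_mult w e < a)%N ->
  cprob R A (Ze e) e w a < t ^+ 2.
Proof.
rewrite val_top_mult ltNge => lea; apply/negP => pa.
have := @leq_bigmax_cond _ (fun a => t ^+ 2 <= cprob R A (Ze e) e w a)
  (fun a : 'I_10 => a : nat) a pa.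
by rewrite leqNgt lea.
Qed.

Lemma cprob_top_mult w e : w \in A -> t ^+ 2 <= cprob R A (Ze e) e w (top_mult w e).
Proof.
move=> wA; pose P (a : 'I_10) := t ^+ 2 <= cprob R A (Ze e) e w a.
have [a Pa] : exists a, P a.
  apply: contrapT => noP; have := sum_cprob R (Ze e) e wA; apply/eqP; rewrite lt_eqF//.
  apply: (@le_lt_trans _ _ (\sum_(a : 'I_10) t ^+ 2)).
    apply: ler_sum => a _; rewrite leNgt; apply/negP => /ltW Pa.
    by apply: noP; exists a.
  rewrite sumr_const card_ord -(mulr_natl (t ^+ 2)).
  have : t * t <= 1 / 4 * (1 / 4) by case/andP: t_bound => *; rewrite ler_pM// ltW.
  by rewrite -expr2; lra.
have [|i Pi iE] := @eq_bigmax_cond _ P (fun a : 'I_10 => a : nat).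
  by apply/card_gt0P; exists a.
suff -> : top_mult w e = i by [].
by apply: val_inj; rewrite /= val_top_mult iE.
Qed.

Definition top_graph (w : word) (x y : V) : nat :=
  if x == y then 0%N else top_mult w [set x; y].

Definition exceptional : {set word} :=
  [set w in A | ~~ `[< locally_sparse Y (top_graph w) >]].

Lemma exceptional_le :
  (t ^+ 2) ^+ #|edges Y| * (#|exceptional|%:R / #|A|%:R) <=
  #|edges Y|%:R * (h (#|S| + 2) - h (#|S| + #|Y|)).
Proof.
have sub : exceptional \subset A by apply/subsetP => w; rewrite inE => /andP[].
have := @entropy_gap_exceptional R _ _ A A0 Z (edges Y) (fun e => Ze e)
  exceptional top_mult (t ^+ 2) edge_sample_sub sub (exprn_ge0 2 (ltW t0)).
rewrite (eq_bigr (fun=> h (#|S| + 2))) => [|e]; last exact: edge_entropyE.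
rewrite sumr_const -(mulr_natl (h _)) sample_edgesE => gap.
have cSY : #|S :|: Y| = (#|S| + #|Y|)%N.
  by rewrite cardsU disjoint_setI0// cards0 subn0.
have chain : #|edges Y|%:R * h (#|S| + #|Y|) <= H (edges (S :|: Y)) - H Z.
  have := @entropy_ge_chain R _ _ A A0 Z (edges Y) (h (#|S| + #|Y|)).
  rewrite sample_edgesE; apply=> [|e eY].
    by rewrite -setI_eq0; apply/eqP/setP => e; rewrite in_setI in_setD in_set0;
      case: (e \in edges Y); rewrite ?andbF.
  rewrite -cSY -(cond_entropyE _ (subsetP (edgesS (subsetUr S Y)) _ eY)).
  exact: lexx.
rewrite mulrBr; apply: le_trans (lerB (lexx _) chain); rewrite lerBrDl.
apply: gap => [w e /(subsetP sub) wA _|w v]; first exact: cprob_top_mult.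
rewrite inE => /andP[_ /asboolPn nsp] vA vw; apply: nsp.
have vE x y : x \in Y -> y \in Y -> top_graph w x y = mult v x y.
  move=> xY yY; rewrite /top_graph /mult; case: eqP => [->|/eqP xy].
    have /sparse_wordsP[v0 _] := vA.
    by rewrite v0// inE setUid cards1 andbF.
  by rewrite vw// edges_set2// xY.
move=> x y z r xY yY zY rY u; rewrite !vE//.
exact: (locally_sparse_mult vA xY yY zY rY u).
Qed.

Lemma top_graph_agree w v e : agree (Ze e) w v -> top_mult w e = top_mult v e.
Proof.
move=> wv; congr inord; apply: eq_bigl => a.
by rewrite (@cprob_agree R _ _ A _ e _ _ a wv).
Qed.

Lemma edge_entropy_top (e : {set V}) : e \in edges Y ->
  h (#|S| + 2) <= mean A (fun w => ln (top_mult w e).+1%:R) + 20 * t.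
Proof.
move=> eY; rewrite -(edge_entropyE eY).
have t1 : 0 < t <= 1 by rewrite t0/=; case/andP: t_bound => *; lra.
have := @entropy_step_le R _ _ A A0 (Ze e) e (fun w => top_mult w e) t t1.
move=> /(_ (fun w v => @top_graph_agree w v e)).
move=> /(_ (fun w a _ => @cprob_gt_top_mult w e a)) /le_trans; apply.
by rewrite lerD2l mulr2n; lra.
Qed.

Lemma edge_entropy_total (B : R) :
    (forall c : V -> V -> nat, (forall x y, c x y = c y x) ->
       (forall x, c x x = 0%N) -> (forall x y, (c x y <= 9)%N) ->
       locally_sparse Y c -> \sum_(x in Y) logdeg R c Y x <= B) -> 0 <= B ->
  2 * #|edges Y|%:R * h (#|S| + 2) <=
  B + #|Y|%:R ^+ 2 * ln 10 * (#|exceptional|%:R / #|A|%:R) +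
  2 * #|edges Y|%:R * (20 * t).
Proof.
move=> YB B0; rewrite -!mulrA -lerBlDr -mulrBr -mulrBr.
apply: (@le_trans _ _
    (2 * \sum_(e in edges Y) mean A (fun w => ln (top_mult w e).+1%:R))).
  rewrite ler_pM2l// (mulr_natl (_ - _)) -sumr_const; apply: ler_sum => e eY.
  by rewrite lerBlDr edge_entropy_top.
rewrite -mean_sum -meanZ.
have -> : #|exceptional|%:R / #|A|%:R = mean A (fun w => (w \in exceptional)%:R) :> R.
  congr (_ / _); rewrite -sum1_card natr_sum big_mkcond [RHS]big_mkcond.
  apply: eq_bigr => w _; rewrite [w \in exceptional]in_set.
  by case: (w \in A) => //=; case: ifP.
rewrite -!meanZ -[X in _ <= X + _](mean_cst A0) -meanD; apply: ler_mean => // w wA.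
have top_sum : 2 * (\sum_(e in edges Y) ln (top_mult w e).+1%:R) =
    \sum_(x in Y) logdeg R (top_graph w) Y x.
  rewrite mulr_natl -(sum_ordered_pairs (fun e => ln (top_mult w e).+1%:R)).
  apply: eq_bigr => x _; rewrite /logdeg big_mkcondr/=; apply: eq_bigr => y _.
  by rewrite /top_graph; case: eqP; rewrite //= ln1.
rewrite top_sum; have tS x y : top_graph w x y = top_graph w y x.
  by rewrite /top_graph eq_sym setUC.
have tI x : top_graph w x x = 0%N by rewrite /top_graph eqxx.
have t9 x y : (top_graph w x y <= 9)%N.
  by rewrite /top_graph; case: ifP => // _; rewrite -ltnS.
have L0 : 0 <= ln 10 :> R by rewrite ln_ge0// ler1n.
rewrite inE wA /=; case: asboolP => [/(YB _ tS tI t9)|_] /=.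
  by rewrite !mulr0 addr0.
rewrite mulr1 ler_wpDl// mulr_natl -sumr_const.
apply: ler_sum => x _; rewrite mulr_natl -sumr_const; apply: ler_sum => y _.
by rewrite ler_ln ?posrE ?ltr0n// ler_nat ltnS.
Qed.
End Sample.

Lemma entropy_sparse_words (S : {set V}) : (#|S| + 2 <= n)%N ->
  ln #|A|%:R <= #|S|%:R * n%:R * ln 10 + n%:R ^+ 2 / 2 * h (#|S| + 2).
Proof.
move=> Sn; have h0 : 0 <= h (#|S| + 2).
  by apply: edge_entropy_ge0; rewrite Sn addn2.
have dis : [disjoint S & ~: S] by rewrite -setI_eq0 setICr.
have <- : H (edges [set: V]) = ln #|A|%:R.
  apply: (@entropy_determined R _ _ A A0) => w v.
  move=> /sparse_wordsP[w0 _] /sparse_wordsP[v0 _] /agreeP wv; apply/ffunP => e.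
  by case: (boolP (e \in edges [set: V])) => [/wv|eT]; rewrite // w0// v0.
have setE : S :|: ~: S = [set: V] by rewrite setUCr.
have := @entropy_subadditive R _ _ A A0 (edges (S :|: ~: S) :\: edges (~: S))
  (edges (~: S)) (fun e => edges (S :|: e) :\ e) (edge_sample_sub dis).
rewrite sample_edgesE setE (eq_bigr (fun=> h (#|S| + 2))) => [|e]; last first.
  exact: edge_entropyE.
rewrite sumr_const -(mulr_natl (h _)) => sub.
have := @entropy_le_card R _ _ A A0 (edges [set: V] :\: edges (~: S)) => HZ.
have cZ : (#|edges [set: V] :\: edges (~: S)| <= #|S| * n)%N.
  rewrite (_ : (#|S| * n)%N = #|setX S [set: V]|); last first.
    by rewrite cardsX cardsT card_ord.
  apply: leq_trans (leq_imset_card (fun p : V * V => [set p.1; p.2]) _).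
  apply/subset_leq_card/subsetP => e; rewrite in_setD => /andP[eS].
  move=> /edgesP[x [y [xy _ _ eE]]]; subst e; move: eS; rewrite edges_set2// !inE.
  rewrite negb_and !negbK => /orP[xS|yS].
    by apply/imsetP; exists (x, y); rewrite // !inE xS.
  by apply/imsetP; exists (y, x); rewrite ?inE ?yS//= setUC.
have cT : #|edges (~: S)|%:R <= n%:R ^+ 2 / 2 :> R.
  rewrite ler_pdivlMr// -natrX -natrM ler_nat card_edges bin2.
  apply: (@leq_trans (#|~: S| ^ 2)%N).
    rewrite -mulnn muln2 -[leqRHS]odd_double_half.
    rewrite (leq_trans _ (leq_addl _ _))// leq_double half_leq//.
    by rewrite leq_mul2l leq_pred orbT.
  by rewrite leq_exp2r// -[leqRHS]card_ord max_card.
have L0 : 0 <= ln 10 :> R by rewrite ln_ge0// ler1n.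
have {}HZ := le_trans HZ (ler_wpM2r L0 (_ : _ <= #|S|%:R * n%:R)).
have {}cT := ler_wpM2r h0 cT.
have {}HZ : H (edges [set: V] :\: edges (~: S)) <= #|S|%:R * n%:R * ln 10.
  by apply: HZ; rewrite -natrM ler_nat.
lra.
Qed.

End Core.

Lemma exists_small_drop (R : realType) (f : nat -> R) (T : nat) (C : R) :
  (0 < T)%N -> f 0%N - f T <= C -> exists2 j, (j < T)%N & f j - f j.+1 <= C / T%:R.
Proof.
move=> T0 fC; apply: contrapT => nodrop.
have drop j : (j < T)%N -> C / T%:R < f j - f j.+1.
  by move=> jT; rewrite ltNge; apply/negP => le; apply: nodrop; exists j.
suff : C < f 0%N - f T by rewrite ltNge fC.
have -> : f 0%N - f T = \sum_(0 <= j < T) (f j - f j.+1).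
  rewrite -[LHS]opprB -telescope_sumr// -sumrN.
  by apply: eq_bigr => j _; rewrite opprB.
have T0' : T%:R != 0 :> R by rewrite pnatr_eq0 -lt0n.
rewrite -[ltLHS](divfK T0') mulr_natr.
rewrite (_ : C / T%:R *+ T = \sum_(0 <= j < T) C / T%:R); last first.
  by rewrite sumr_const_nat subn0.
rewrite !big_mkord; apply: ltr_sum => [|j _]; last exact: drop.
by apply/hasP; exists (Ordinal T0); rewrite ?mem_index_enum.
Qed.

Lemma ln_sparse_words_le (R : realType) (e : R) : 0 < e ->
  exists N : nat, forall n, (N <= n)%N ->
    ln #|sparse_words n|%:R <= (beta R * ln 3 / 2 + e) * n%:R ^+ 2.
Proof.
move=> e0; set D := beta R * ln 3.
have L0 : 0 < ln 10 :> R by rewrite ln_gt0// ltr1n.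
have D0 : 0 < D by rewrite mulr_gt0 ?beta_gt0// ln_gt0// ltr1n.
have e8 : 0 < e / 8 by rewrite divr_gt0.
have [M0 exM0] := @logdeg_total_asymptotic R (e / 8) e8.
pose K1 := 8 * (D + e / 8) / e.
have K10 : 0 <= K1 by rewrite divr_ge0 ?(ltW e0)// mulr_ge0// ltW// addr_gt0.
pose m := maxn M0 (Num.bound K1).+2.
have m2 : (2 <= m)%N by rewrite leq_max orbT.
have mK : D + e / 8 <= e / 8 * (m%:R - 1).
  have : K1 <= m%:R - 1.
    apply: ltW; apply: lt_le_trans (archi_boundP K10) _.
    by rewrite lerBrDr natr1 ler_nat leq_max leqnSn orbT.
  rewrite /K1 ler_pdivrMr// => h; lra.
have [t tb te] : exists2 t : R, 0 < t <= 1 / 4 & 20 * t <= e / 8.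
  exists (Num.min (1 / 4) (e / 160)); first by rewrite lt_min ge_min lexx !divr_gt0.
  by rewrite -ler_pdivlMl// ge_min; apply/orP; right; lra.
have t0 : 0 < t by case/andP: tb.
pose M := 'C(m, 2); pose d := (t ^+ 2) ^+ M.
have d0 : 0 < d by rewrite !exprn_gt0.
have ME : 2 * M%:R = m%:R * (m%:R - 1) :> R.
  rewrite -natrM mul2n /M bin2 -[m in m%:R - 1]prednK ?(ltn_trans _ m2)// -natr1 addrK.
  by rewrite -natrM halfK oddM; case: (m) m2 => // m' _; rewrite /= andNb subn0.
have Mgt0 : 0 < 2 * M%:R :> R.
  by rewrite ME mulr_gt0 ?subr_gt0 ?ltr1n// ltr0n ltnW.
pose K2 := 16 * ln 10 * (M%:R * ln 10) / (d * e).
have K20 : 0 <= K2.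
  by rewrite divr_ge0 ?mulr_ge0// ?(ltW L0) ?(ltW d0) ?(ltW e0).
pose T := (Num.bound K2).+1.
have TK2 : K2 <= T%:R.
  by apply: ltW; apply: lt_le_trans (archi_boundP K20) _; rewrite ler_nat leqnSn.
have T0 : 0 < T%:R :> R by [].
pose K3 := 2 * (T * m)%:R * ln 10 / e.
have K30 : 0 <= K3 by rewrite divr_ge0 ?(ltW e0)// !mulr_ge0// ltW.
exists (maxn (T * m + 2) (Num.bound K3)) => n; rewrite geq_max => /andP[nT nK].
have nK3 : K3 <= n%:R.
  by apply: ltW; apply: lt_le_trans (archi_boundP K30) _; rewrite ler_nat.
set h := edge_entropy R n.
have [||j jT hj] := @exists_small_drop R (fun j => h (j * m + 2)%N) T (ln 10).
- by [].
- rewrite mul0n add0n lerBlDr; apply: (le_trans (@edge_entropy_le_ln10 R n 2 _)).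
    by rewrite leqnn /= (leq_trans _ nT)// leq_addl.
  by rewrite lerDl edge_entropy_ge0// leq_addl.
pose k := (j * m)%N.
have kmn : (k + m + 2 <= n)%N.
  by apply: leq_trans nT; rewrite leq_add2r -mulSnr leq_mul2r jT orbT.
have kn : (k <= n)%N by move: kmn; clear; lia.
pose S : {set 'I_n} := init n k; pose Y : {set 'I_n} := init n (k + m) :\: S.
have cS : #|S| = k by exact: card_init.
have cY : #|Y| = m.
  rewrite cardsD (_ : _ :&: _ = S) ?cS ?card_init; first by rewrite addKn.
    by move: kmn; clear; lia.
  apply/setIidPr/subsetP => x; rewrite !inE; move/leq_trans; apply; exact: leq_addr.
have dis : [disjoint S & Y].
  rewrite -setI_eq0; apply/eqP/setP => x; rewrite !inE.
  by case: (x < k)%N; rewrite ?andbF.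
have cE : #|edges Y| = M by rewrite card_edges cY.
set r : R := #|exceptional S Y t|%:R / #|sparse_words n|%:R.
have rM : 2 * ln 10 * r <= e / 8.
  have := exceptional_le dis tb; rewrite cE cS cY -/r -/d -/h => exc.
  have hkm : h (k + m + 2) <= h (k + m) 
    by apply: edge_entropy_le => //; move: m2; clear; lia.
  have {}exc : d * r <= M%:R * (ln 10 / T%:R).
    apply: (le_trans exc); rewrite ler_wpM2l//; apply: le_trans hj.
    by rewrite lerB// mulSn -/k (addnC m).
  have {}exc : r <= M%:R * (ln 10 / T%:R) / d by rewrite ler_pdivlMr// mulrC.
  have : 16 * ln 10 * (M%:R * (ln 10 / T%:R) / d) <= e.
    rewrite (_ : _ * _ = K2 * e / T%:R); last first.
      by rewrite /K2; field; rewrite !gt_eqF.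
    by rewrite ler_pdivrMr// mulrC ler_wpM2l// ltW.
  have := ler_wpM2l (ltW L0) exc; lra.
have B0 : 0 <= (D + e / 8) * m%:R ^+ 2.
  by rewrite mulr_ge0 ?exprn_ge0// ltW// addr_gt0.
have hk : h (k + 2) <= D + e / 2.
  have := @edge_entropy_total R n S Y dis t tb ((D + e / 8) * m%:R ^+ 2) _ B0.
  rewrite cE cS cY -/r -/h => H; have {}H := H _; rewrite -(ler_pM2l Mgt0).
  have mm : m%:R ^+ 2 = 2 * M%:R + m%:R :> R by rewrite ME; lra.
  have m0 : 0 <= m%:R :> R by [].
  have h1 : m%:R * (D + e / 8) <= e / 8 * (2 * M%:R).
    by rewrite ME mulrCA ler_wpM2l.
  have m12 : m%:R <= 2 * M%:R :> R.
    by rewrite ME ler_peMr// lerBrDr -[1 + 1]/(2%:R) ler_nat.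
  have r0 : 0 <= r by rewrite divr_ge0.
  have h2 : m%:R ^+ 2 * ln 10 * r <= 2 * M%:R * (2 * ln 10 * r).
    rewrite (_ : 2 * M%:R * _ = 2 * (2 * M%:R) * (ln 10 * r)); last by ring.
    by rewrite -mulrA ler_wpM2r ?mulr_ge0// ?(ltW L0)// mm; lra.
  have h3 := ler_wpM2l (ltW Mgt0) rM.
  have h4 := ler_wpM2l (ltW Mgt0) te.
  apply: le_trans (H _) _ => [c cs ci c9 cX|].
    by rewrite -[m in leRHS]cY; apply: exM0; rewrite // cY leq_max leqnn.
  rewrite {1}mm; move: h1 h2 h3 h4; clear; lra.
have kn2 : (#|S| + 2 <= n)%N by rewrite cS; move: kmn; clear; lia.
apply: le_trans (entropy_sparse_words R kn2) _; rewrite cS -/h.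
have n0 : 0 <= n%:R :> R by [].
have n20 : 0 <= n%:R ^+ 2 / 2 :> R by rewrite divr_ge0// exprn_ge0.
have h1 := ler_wpM2l n20 hk.
have h2 : k%:R * ln 10 <= e / 2 * n%:R.
  have : (T * m)%:R * ln 10 <= e / 2 * n%:R.
    rewrite (_ : _ * _ = e / 2 * K3); last by rewrite /K3; field; rewrite gt_eqF.
    by rewrite ler_wpM2l// divr_ge0// ltW.
  apply: le_trans; rewrite ler_wpM2r ?(ltW L0)// ler_nat.
  by rewrite leq_mul2r (ltnW jT) orbT.
have h3 := ler_wpM2r n0 h2.
have h4 : 0 <= e * n%:R ^+ 2 by rewrite mulr_ge0 ?exprn_ge0// ltW.
lra.
Qed.

(** * The lower bound *)

Section LowerBound.
Variables (R : realType) (n : nat) (P : {set 'I_n}).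
Local Notation V := 'I_n.

Definition cap (e : {set V}) : nat :=
  if e \notin edges [set: V] then 0%N
  else if e \subset P then 1%N else if e \subset ~: P then 0%N else 2.

Lemma cap_le2 e : (cap e <= 2)%N.
Proof. by rewrite /cap; do 3! case: ifP => //. Qed.

Lemma cap_set2 x y : x != y -> cap [set x; y] =
  (if x \in P then if y \in P then 1 else 2 else if y \in P then 2 else 0)%N.
Proof.
move=> xy; rewrite /cap edges_set2// !inE /= !subUset !sub1set !inE.
by case: (x \in P); case: (y \in P).
Qed.

Lemma capped_sparse (w : {ffun {set V} -> 'I_10}) :
  (forall e, (w e <= cap e)%N) -> w \in sparse_words n.
Proof.
move=> wc; apply/sparse_wordsP; split=> [e eT|X X4].
  by apply/val_inj/eqP; rewrite /= -leqn0 (leq_trans (wc e))// /cap eT.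
apply: (@leq_trans (\sum_(e in edges X) cap e)); first by apply: leq_sum.
have : size (enum X) = 4 by rewrite -cardE.
case EX : (enum X) => [|x [|y [|z [|t [|? ?]]]]]// _.
have u : uniq [:: x; y; z; t] by rewrite -EX enum_uniq.
have -> : X = [set v in [:: x; y; z; t]].
  by apply/setP => v; rewrite inE -EX mem_enum.
rewrite sum_edges4//; move: u; rewrite /= !inE !negb_or -!andbA.
move=> /and5P[xy xz xt yz /and3P[yt zt _]]; rewrite !cap_set2//.
by case: (x \in P); case: (y \in P); case: (z \in P); case: (t \in P).
Qed.

Lemma prod_cap_le : (\prod_e (cap e).+1 <= #|sparse_words n|)%N.
Proof.
pose Fm := family (fun e : {set V} => [pred k : 'I_10 | (k <= cap e)%N]).
rewrite (_ : (\prod_e _)%N = #|Fm|); last first.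
  rewrite card_family foldrE big_image /=; apply: eq_bigr => e _.
  rewrite -sum1_card (eq_bigl (fun k : 'I_10 => (k < (cap e).+1)%N))//.
  rewrite -(big_ord_widen 10 (fun=> 1)%N) ?sum1_card ?card_ord//.
  by rewrite ltnS (leq_trans (cap_le2 e)).
by apply/subset_leq_card/subsetP => w /familyP wF; apply: capped_sparse.
Qed.

Lemma ln_sparse_words_ge :
  #|P|%:R ^+ 2 * ln 2 + 2 * #|P|%:R * (n%:R - #|P|%:R) * ln 3 - #|P|%:R * ln 2 <=
  2 * ln #|sparse_words n|%:R :> R.
Proof.
have L0 k : 0 <= ln k.+1%:R :> R by rewrite ln_ge0// ler1n.
apply: (@le_trans _ _ (2 * \sum_(e in edges [set: V]) ln (cap e).+1%:R)); last first.
  rewrite ler_pM2l//.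
  apply: (@le_trans _ _ (ln (\prod_e (cap e).+1)%:R)); last first.
    rewrite ler_ln ?posrE ?ltr0n ?sparse_words_gt0//; last by rewrite prodn_gt0.
    by rewrite ler_nat prod_cap_le.
  rewrite natr_prod ln_prod// big_mkcond; apply: ler_sum => e _.
  by case: ifP.
rewrite (mulr_natl (\sum_(e in _) _)) -(sum_ordered_pairs (fun e => ln (cap e).+1%:R)).
pose p x : R := (x \in P)%:R.
pose G x y : R := ln 2 * (p x * p y) + ln 3 * (p x + p y - 2 * (p x * p y)).
rewrite (eq_bigr (fun x => \sum_y G x y - ln 2 * p x)); last first.
  move=> x _; rewrite [in RHS](bigD1 x)//= [RHS]addrAC (_ : G x x - _ = 0); last first.
    by rewrite /G /p; case: (x \in P) => /=; rewrite ?mulr0n ?mulr1n; lra.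
  rewrite add0r; apply: eq_big => [y|y]; first by rewrite inE eq_sym.
  move=> /andP[_ xy]; rewrite cap_set2// /G /p.
  by case: (x \in P); case: (y \in P) => /=; rewrite ?ln1 ?mulr0n ?mulr1n; lra.
have sp : \sum_(x in [set: V]) p x = #|P|%:R.
  rewrite sum_indicator; congr _%:R; apply: eq_card => x; rewrite !inE//.
have spT : \sum_x p x = #|P|%:R.
  by rewrite -sp; apply: eq_bigl => x; rewrite inE.
have sG x : \sum_y G x y = (ln 2 - 2 * ln 3) * #|P|%:R * p x
    + ln 3 * n%:R * p x + ln 3 * #|P|%:R.
  rewrite /G (eq_bigr (fun y => (ln 2 - 2 * ln 3) * p x * p y + ln 3 * p x + ln 3 * p y)).
    rewrite !big_split/= -!mulr_sumr sumr_const card_ord -(mulr_natr (p x)) spT.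
    by lra.
  by move=> y _; lra.
rewrite (eq_bigr (fun x => ((ln 2 - 2 * ln 3) * #|P|%:R + ln 3 * n%:R - ln 2) * p x
    + ln 3 * #|P|%:R)); last by move=> x _; rewrite sG; lra.
rewrite big_split/= -mulr_sumr sp sumr_const cardsT card_ord -(mulr_natr (ln 3 * _)).
lra.
Qed.
End LowerBound.

Lemma ln_sparse_words_lower (R : realType) n :
  beta R * ln 3 * n%:R ^+ 2 - (3 * ln 2 + 2 * ln 3) * n%:R <=
  2 * ln #|sparse_words n|%:R.
Proof.
have b0 := beta_gt0 R; have b1 := beta_lt1 R; have l20 := ln2_gt0 R.
have l23 := ln2_le_ln3 R; have l30 : 0 <= ln 3 :> R by lra.
have n0 : 0 <= n%:R :> R by [].
pose x := beta R * n%:R; have x0 : 0 <= x by rewrite mulr_ge0// ltW.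
have xn : x <= n%:R by rewrite ler_piMl// ltW.
have /andP[ax xa] := truncn_itv x0; set a := Num.Def.trunc x in ax xa.
have an : (a <= n)%N by rewrite -(ler_nat R) (le_trans ax).
have := ln_sparse_words_ge R (init n a); rewrite card_init//; apply: le_trans.
rewrite -natr1 in xa.
have a0 : 0 <= a%:R :> R by [].
have h1 : x ^+ 2 - 2 * n%:R <= a%:R ^+ 2 by nra.
have h2 : x * (n%:R - x) - n%:R <= a%:R * (n%:R - a%:R) by nra.
have h3 : a%:R <= n%:R :> R by rewrite ler_nat.
have := ler_wpM2r (ltW l20) h1; have := ler_wpM2r l30 h2.
have := ler_wpM2r (ltW l20) h3.
have -> : beta R * ln 3 * n%:R ^+ 2 = x ^+ 2 * ln 2 + 2 * (x * (n%:R - x) * ln 3).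
  transitivity (beta R * (beta R * ln 2 + 2 * ln 3 - 2 * (beta R * ln 3)) * n%:R ^+ 2).
    by congr (_ * _ * _); have := betaE R; lra.
  by rewrite /x; ring.
lra.
Qed.

Section Counting.
Variable n : nat.
Hypothesis n4 : (4 <= n)%N.
Local Notation V := 'I_n.

Definition graph_of_word (w : {ffun {set V} -> 'I_10}) : multigraph V :=
  [ffun e : pair2 V => nat_of_ord (w (val e))].

Lemma span_mult_graph (f : {set V} -> nat) (w : multigraph V) (X : {set V}) :
  (forall e, w e = f (val e)) ->
  span_mult w X = (\sum_(e in edges X) f e)%N.
Proof.
move=> wf; rewrite /span_mult.
have -> : edges X = val @: [set e : pair2 V | val e \subset X].
  apply/setP => e; apply/idP/imsetP => [|[p + ->]].
    by rewrite inE => /andP[eX e2]; exists (Sub e e2 : pair2 V); rewrite ?inE ?SubK.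
  by rewrite !inE => ->; rewrite (valP p).
rewrite big_imset/=; last by move=> p q _ _; apply: val_inj.
by apply: eq_big => e; rewrite ?inE ?wf.
Qed.

Lemma pair_in_quad (e : {set V}) : #|e| = 2 ->
  exists2 X : {set V}, #|X| = 4 & e \subset X.
Proof.
move=> e2; have : (0 < #|[set B : {set V} | B \subset ~: e & #|B| == 2]|)%N.
  rewrite cards_draws bin_gt0.
  by have := cardsC e; rewrite e2 card_ord; move: n4; clear; lia.
move=> /card_gt0P[B]; rewrite inE => /andP[Be /eqP B2].
exists (e :|: B); last exact: subsetUl.
rewrite cardsU e2 B2 (_ : _ :&: _ = set0) ?cards0//.
by apply/eqP; rewrite setI_eq0 disjoint_sym disjoints_subset.
Qed.

Lemma multiplicity_le9 (w : multigraph V) e : F n 4 9 w -> (w e <= 9)%N.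
Proof.
move=> wF; have [X X4 eX] := pair_in_quad (eqP (valP e)).
apply: leq_trans (wF X X4).
by rewrite /span_mult (bigD1 e)//= leq_addr.
Qed.

Definition word_of_graph (w : multigraph V) : {ffun {set V} -> 'I_10} :=
  [ffun e => if insub e is Some p then inord (w p) else ord0].

Lemma word_of_graphK (w : multigraph V) : F n 4 9 w ->
  graph_of_word (word_of_graph w) = w.
Proof.
move=> wF; apply/ffunP => e; rewrite !ffunE valK inordK//.
by rewrite ltnS multiplicity_le9.
Qed.

Lemma word_of_graph_sparse (w : multigraph V) : F n 4 9 w ->
  word_of_graph w \in sparse_words n.
Proof.
move=> wF; apply/sparse_wordsP; split=> [e|X X4].
  by rewrite inE subsetT /= => e2; rewrite ffunE insubN.
rewrite -(@span_mult_graph _ w) ?wF// => e.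
by rewrite -{1}(word_of_graphK wF) ffunE.
Qed.

Lemma F_imageE : F n 4 9 = (graph_of_word @` [set` sparse_words n])%classic.
Proof.
apply/seteqP; split=> [w wF|_ [w wS <-] X X4] /=.
  by exists (word_of_graph w); [exact: word_of_graph_sparse|exact: word_of_graphK].
have /sparse_wordsP[_ w9] : w \in sparse_words n by [].
rewrite (@span_mult_graph (fun e => nat_of_ord (w e))) ?w9// => e.
by rewrite ffunE.
Qed.

Lemma card_FE : card_F n 4 9 = #|sparse_words n|.
Proof.
have finS : finite_set [set` sparse_words n]%classic by exact: finite_finset.
rewrite /card_F F_imageE fset_set_image// card_in_imfset/=.
  rewrite [RHS]cardE; apply/perm_size/uniq_perm => [||v]; rewrite ?fset_uniq ?enum_uniq//.
  by rewrite in_fset_set// mem_enum; apply/idP/idP => [/set_mem|/mem_set].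
move=> v w; rewrite !in_fset_set// => /set_mem/sparse_wordsP[v0 _].
move=> /set_mem/sparse_wordsP[w0 _].
move=> /ffunP vw; apply/ffunP => e.
have [eT|eT] := boolP (e \in edges [set: V]); last by rewrite v0// w0.
have e2 : #|e| == 2 by move: eT; rewrite inE => /andP[].
by have := vw (Sub e e2); rewrite !ffunE SubK => /val_inj.
Qed.
End Counting.

Import numFieldNormedType.Exports.
Local Open Scope classical_set_scope.
Local Open Scope ring_scope.

Theorem theorem2p5 (R : realType) :
  exists err : nat -> R,
    (err =o_\oo (fun n : nat => n%:R ^+ 2 : R)) /\
    (forall n : nat, (4 <= n)%N ->
       (card_F n 4 9)%:R = 2 `^ (gamma R * n%:R ^+ 2 + err n)).
Proof.
have l20 := ln2_gt0 R; have gE := beta_ln3_gammaE R.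
exists (fun n => ln (card_F n 4 9)%:R / ln 2 - gamma R * n%:R ^+ 2); split; last first.
  move=> n n4; rewrite addrC subrK.
  have A0 : 0 < (card_F n 4 9)%:R :> R by rewrite ltr0n card_FE// sparse_words_gt0.
  by apply: ln_inj; rewrite ?posrE ?powR_gt0// ln_powR divfK// gt_eqF.
apply/eqoP => e e0.
have el0 : 0 < e * ln 2 by rewrite mulr_gt0.
have [N upper] := ln_sparse_words_le el0.
near=> n.
have n4 : (4 <= n)%N by near: n; exact: nbhs_infty_ge.
have nN : (N <= n)%N by near: n; exact: nbhs_infty_ge.
have nC : (3 * ln 2 + 2 * ln 3) / (e * ln 2) <= n%:R.
  by near: n; exact: nbhs_infty_ger.
have n0 : 0 <= n%:R :> R by [].
rewrite card_FE// (ger0_norm (exprn_ge0 2 n0)).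
have up := upper n nN; have low := ln_sparse_words_lower R n.
rewrite -gE in up low.
move: nC; rewrite ler_pdivrMr// => /(ler_wpM2r n0) nC.
have en0 : 0 <= n%:R * (e * ln 2) * n%:R by rewrite !mulr_ge0// ltW.
set L := ln _ in up low *.
have -> : L / ln 2 - gamma R * n%:R ^+ 2 = (L - gamma R * ln 2 * n%:R ^+ 2) / ln 2.
  by field; rewrite gt_eqF.
rewrite ler_norml ler_pdivrMr// ler_pdivlMr//.
apply/andP; split; move: up low nC en0; clear; lra.
Unshelve. all: by end_near. Qed.
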